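(* Let $X$ and $Y$ be infinite-dimensional Banach spaces with $\operatorname{density}(X)>\operatorname{density}(Y)$, and let $T:X\to Y$ be a surjective bounded linear operator. Let $S$ be a two-sorted metric signature, each sort of which is the signature of Banach spaces, together with a symbol to represent $T$, and let $L$ be a countable continuous fragment of $\mathcal{L}_{\omega_1,\omega}(S)$. Then there are Banach spaces $X',Y'$ with $Y'$ separable and $X'$ of density $\aleph_1$, and a surjective bounded linear operator $T':X'\to Y'$, such that $(X,Y,T)\equiv_L(X',Y',T')$.
   Context: Density means the least cardinality of a dense subset. Metric structures. A metric structure consists of a metric space (or several, in the many-sorted case) with metric bounded by $1$, together with uniformly continuous functions between (finite products of) sorts, uniformly continuous $[0,1]$-valued predicates, and distinguished elements. A metric signature $S$ consists of function and predicate symbols, each with an arity (and sorts) and a modulus of uniform continuity, and constant symbols; $S$-structures interpret the symbols respecting these moduli. Banach spaces are unbounded, so, as usual, a Banach space is treated as a metric structure either through its unit ball or as a many-sorted structure whose sorts are the closed balls of integer radius with metrics scaled to be bounded by $1$, equipped with the (suitably restricted and scaled) vector space operations and the norm. The operator $T$ is represented by function symbol(s) for its restrictions to the balls. The triple $(X,Y,T)$ denotes the resulting structure. Formulas. Terms are as in first-order logic. Atomic formulas: $d(t_1,t_2)$ and $P(t_1,\dots,t_n)$ for terms $t_i$. Formulas of $\mathcal{L}_{\omega_1,\omega}(S)$ are built from atomic formulas and constants $q\in\mathbb{Q}\cap[0,1]$ by $\varphi\to\psi$, by $\sup_x\varphi$, and by $\sup_{n<\omega}\varphi_n$ when the total number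 of free variables in all $\varphi_n$ is finite. Truth values $\varphi^{\mathcal{M}}(\bar a)\in[0,1]$ are defined by recursion: atomic formulas and constants in the obvious way, $(\psi\to\theta)^{\mathcal M}=\min\{1-\psi^{\mathcal M}+\theta^{\mathcal M},1\}$, and $\sup_{n}$, $\sup_x$ are suprema over $n<\omega$ and over $x$ in the relevant sort. $\neg\varphi$ abbreviates $\varphi\to 0$. Fragments. A fragment of $\mathcal{L}_{\omega_1,\omega}(S)$ is a set $L$ of $\mathcal{L}_{\omega_1,\omega}(S)$-formulas that contains every atomic formula and every constant formula $q\in\mathbb{Q}\cap[0,1]$, is closed under $\sup_x$, $\to$ and $\neg$, and is closed under substituting terms for variables. It is continuous if for every $L$-formula $\varphi(x_1,\dots,x_n)$ and every $S$-structure $\mathcal{M}$ (not necessarily complete), the function $\bar a\mapsto\varphi^{\mathcal M}(\bar a)$ is continuous. $\mathcal{M}\equiv_L\mathcal{N}$ means $\sigma^{\mathcal M}=\sigma^{\mathcal N}$ for all $L$-sentences $\sigma$.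
   Formalization: A fragment is additionally required to be closed under subformulas; otherwise a sentence with discontinuous subformulas, being trivially continuous, could be adjoined, and one such sentence can force Y' to be non-separable, making the claim false. *)

(* Defs.v *)
From HB Require Import structures.
From mathcomp Require Import all_boot all_order all_algebra.
From mathcomp Require Import all_classical all_reals.
From mathcomp Require Import interval_inference topology normedtype.

Set Implicit Arguments.
Unset Strict Implicit.
Unset Printing Implicit Defensive.

Import Order.TTheory GRing.Theory Num.Theory.
Import numFieldNormedType.Exports.

Local Open Scope classical_set_scope.
Local Open Scope card_scope.
Local Open Scope ring_scope.

(* A context is a finite list of sorts; [var G s] is the type of positions of
   sort [s] in [G].  Terms and formulas below are indexed by the context that
   contains their free variables.  Arities are contexts too, so that tuples of
   arguments and assignments of variables are both environments. *)
Inductive var (I : Type) : seq I -> I -> Type :=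
| VZ (G : seq I) (s : I) : var (s :: G) s
| VS (G : seq I) (s t : I) : var G s -> var (t :: G) s.

Arguments VZ {I G s}.
Arguments VS {I G s t}.

Definition env (I : Type) (M : I -> Type) (G : seq I) : Type :=
  forall s, var G s -> M s.

Definition env_nil (I : Type) (M : I -> Type) : env M [::] :=
  fun s v => match v in var G s return (if G is [::] then M s else unit) with
             | VZ _ _ => tt
             | VS _ _ _ _ => tt
             end.

Definition env_cons (I : Type) (M : I -> Type) (G : seq I) (t : I)
    (x : M t) (a : env M G) : env M (t :: G) :=
  fun s v =>
    match v in var G' s return
      (if G' is t' :: G'' then M t' -> env M G'' -> M s else unit) with
    | VZ _ _ => fun x _ => x
    | VS _ _ _ w => fun _ a => a _ w
    end x a.

Record modulus (R : realType) := Modulus {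
  modulus_fun :> R -> R;
  modulus_gt0 : forall e, 0 < e -> 0 < modulus_fun e }.

Record signature (R : realType) := Signature {
  sort : Type;
  func : Type;
  fdom : func -> seq sort;
  fcod : func -> sort;
  fmod : func -> modulus R;
  pred_symb : Type;
  pdom : pred_symb -> seq sort;
  pmod : pred_symb -> modulus R;
  cst : Type;
  cst_sort : cst -> sort }.

(* Closeness of tuples is measured by the maximum of the distances of their
   entries. *)
Definition env_close (R : realType) (I : Type) (M : I -> metricType R)
    (G : seq I) (d : R) (a b : env M G) : Prop :=
  forall s (v : var G s), mdist (a s v) (b s v) < d.

(* The carriers need not be complete. *)
Record structure (R : realType) (S : signature R) := Structure {
  carrier :> sort S -> metricType R;
  fint : forall f : func S, env carrier (fdom f) -> carrier (fcod f);
  pint : forall p : pred_symb S, env carrier (pdom p) -> R;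
  cint : forall c : cst S, carrier (cst_sort c);
  mdist_le1 : forall s (x y : carrier s), mdist x y <= 1;
  pint01 : forall (p : pred_symb S) (a : env carrier (pdom p)),
    0 <= pint a <= 1;
  fintP : forall (f : func S) (e : R), 0 < e ->
    forall a b : env carrier (fdom f),
      env_close (fmod f e) a b -> mdist (fint a) (fint b) <= e;
  pintP : forall (p : pred_symb S) (e : R), 0 < e ->
    forall a b : env carrier (pdom p),
      env_close (pmod p e) a b -> `|pint a - pint b| <= e }.

Inductive term (R : realType) (S : signature R) (G : seq (sort S)) :
    sort S -> Type :=
| Var s : var G s -> term G s
| Cst (c : cst S) : term G (cst_sort c)
| App (f : func S) : (forall s, var (fdom f) s -> term G s) -> term G (fcod f).

(* In [SupN] all the formulas live in one context, i.e. they have altogether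
   finitely many free variables. *)
Inductive formula (R : realType) (S : signature R) : seq (sort S) -> Type :=
| Dist G s : term G s -> term G s -> formula G
| Pred G (p : pred_symb S) : env (term G) (pdom p) -> formula G
| Const G (q : rat) : 0 <= q <= 1 -> formula G
| Imp G : formula G -> formula G -> formula G
| SupN G : (nat -> formula G) -> formula G
| Sup G s : formula (s :: G) -> formula G.

Arguments formula {R} S G.
Arguments Const {R} S G q _.

Definition Neg (R : realType) (S : signature R) (G : seq (sort S))
    (phi : formula S G) : formula S G :=
  Imp phi (Const S G 0 isT).

Fixpoint tsubst (R : realType) (S : signature R) (G D : seq (sort S))
    (r : env (term D) G) s (t : term G s) : term D s :=
  match t with
  | Var s v => r s v
  | Cst c => Cst D c
  | App f ts => App (fun s v => tsubst r (ts s v))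
  end.

Definition lift_subst (R : realType) (S : signature R) (G D : seq (sort S))
    (t : sort S) (r : env (term D) G) : env (term (t :: D)) (t :: G) :=
  env_cons (Var VZ) (fun s v => tsubst (fun s' w => Var (VS w)) (r s v)).

(* Simultaneous capture-avoiding substitution; renaming and weakening of
   variables are special cases. *)
Fixpoint subst (R : realType) (S : signature R) (G D : seq (sort S))
    (r : env (term D) G) (phi : formula S G) : formula S D :=
  match phi in formula _ G return env (term D) G -> formula S D with
  | Dist _ _ t1 t2 => fun r => Dist (tsubst r t1) (tsubst r t2)
  | Pred _ p ts => fun r => Pred (fun s v => tsubst r (ts s v))
  | Const _ q q01 => fun r => Const S D q q01
  | Imp _ phi psi => fun r => Imp (subst r phi) (subst r psi)
  | SupN _ phi => fun r => SupN (fun n => subst r (phi n))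
  | Sup _ _ phi => fun r => Sup (subst (lift_subst r) phi)
  end r.

Section Evaluation.
Context (R : realType) (S : signature R) (M : structure S).

Fixpoint teval (G : seq (sort S)) (a : env (carrier M) G) s (t : term G s) : M s :=
  match t with
  | Var s v => a s v
  | Cst c => cint M c
  | App f ts => fint (fun s v => teval a (ts s v))
  end.

(* All values lie in [0, 1], so the suprema are those of nonempty bounded sets,
   except over an empty sort, where [sup] is 0. *)
Fixpoint eval (G : seq (sort S)) (phi : formula S G) : env (carrier M) G -> R :=
  match phi in formula _ G return env (carrier M) G -> R with
  | Dist _ _ t1 t2 => fun a => mdist (teval a t1) (teval a t2)
  | Pred _ p ts => fun a => pint (fun s v => teval a (ts s v))
  | Const _ q _ => fun=> ratr q
  | Imp _ phi psi => fun a => Num.min (1 - eval phi a + eval psi a) 1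
  | SupN _ phi => fun a => sup (range (fun n => eval (phi n) a))
  | Sup _ s phi => fun a => sup (range (fun x : M s => eval phi (env_cons (M := carrier M) x a)))
  end.

End Evaluation.

Definition formula_set (R : realType) (S : signature R) : Type :=
  forall G, set (formula S G).

(* Besides the closure under the connectives, a fragment is closed under
   subformulas, as usual in infinitary logic.  Without this, an arbitrary
   sentence could be adjoined to a continuous fragment (a sentence is
   trivially continuous), whatever discontinuous subformulas it has. *)
Record fragment (R : realType) (S : signature R) (L : formula_set S) :
    Prop := {
  fragment_dist : forall G s (t1 t2 : term G s), L G (Dist t1 t2);
  fragment_pred : forall G p (ts : env (term G) (pdom p)), L G (Pred ts);
  fragment_const : forall G q q01, L G (Const S G q q01);
  fragment_sup : forall G s (phi : formula S (s :: G)),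
    L (s :: G) phi -> L G (Sup phi);
  fragment_imp : forall G (phi psi : formula S G),
    L G phi -> L G psi -> L G (Imp phi psi);
  fragment_neg : forall G (phi : formula S G), L G phi -> L G (Neg phi);
  fragment_subst : forall G D (r : env (term D) G) (phi : formula S G),
    L G phi -> L D (subst r phi);
  fragment_sub_imp : forall G (phi psi : formula S G),
    L G (Imp phi psi) -> L G phi /\ L G psi;
  fragment_sub_supn : forall G (phi : nat -> formula S G),
    L G (SupN phi) -> forall n, L G (phi n);
  fragment_sub_sup : forall G s (phi : formula S (s :: G)),
    L G (Sup phi) -> L (s :: G) phi }.

Definition countable_formula_set (R : realType) (S : signature R)
    (L : formula_set S) : Prop :=
  countable [set p : {G & formula S G} | L (projT1 p) (projT2 p)].

Definition continuous_formula_set (R : realType) (S : signature R)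
    (L : formula_set S) : Prop :=
  forall G (phi : formula S G), L G phi ->
  forall (M : structure S) (a : env (carrier M) G) (e : R), 0 < e ->
  exists2 d : R, 0 < d &
    forall b : env (carrier M) G, env_close d a b -> `|eval phi a - eval phi b| < e.

Definition equiv_in (R : realType) (S : signature R) (L : formula_set S)
    (M N : structure S) : Prop :=
  forall phi : formula S [::], L [::] phi ->
    eval phi (env_nil (carrier M)) = eval phi (env_nil (carrier N)).

(* Closed ball of radius [n.+1] with the metric scaled to have diameter at most
   1; the sorts of the Banach space are these balls. *)
Definition sball (R : realType) (V : normedModType R) (n : nat) : Type :=
  {x : V | `|x| <= n.+1%:R}.

Section ScaledBall.
Context (R : realType) (V : normedModType R) (n : nat).

HB.instance Definition _ := Choice.on (sball V n).

Definition sdist (x y : sball V n) : R :=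
  `|val x - val y| / (2 * n.+1%:R).

Lemma sdistxx x : sdist x x = 0.
Proof. by rewrite /sdist subrr normr0 mul0r. Qed.

Lemma sdist_positivity x y : sdist x y = 0 -> x = y.
Proof.
move=> /eqP; rewrite mulf_eq0 invr_eq0 mulf_eq0 !pnatr_eq0 !orbF.
by rewrite normr_eq0 subr_eq0 => /eqP; exact: val_inj.
Qed.

Lemma sdist_sym x y : sdist x y = sdist y x.
Proof. by rewrite /sdist distrC. Qed.

Lemma sdist_triangle y x z : sdist x z <= sdist x y + sdist y z.
Proof.
by rewrite /sdist -mulrDl ler_wpM2r ?invr_ge0 ?mulr_ge0// ler_distD.
Qed.

HB.instance Definition _ :=
  isMetric.Build R (sball V n) sdistxx sdist_positivity sdist_sym
    sdist_triangle.

Lemma sdist_le1 (x y : sball V n) : mdist x y <= 1.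
Proof.
rewrite [mdist x y]/(sdist x y) /sdist ler_pdivrMr ?mulr_gt0// mul1r.
by rewrite (le_trans (ler_normB _ _))// mulr_natl mulr2n lerD// (valP x, valP y).
Qed.

End ScaledBall.

Inductive side := Dom | Cod.

(* The sort [(b, n)] is the ball of radius [n.+1] of the domain or of the
   codomain of the operator. *)
Definition op_sort : Type := side * nat.

(* Scalars are rational, so that the signature is countable: with a symbol for
   each real number, no fragment would be countable.
   [FAdd b m n] and [FScale b q m n _] take values in balls that contain the
   sum and the multiple; [FT n] is the restriction of the operator to the ball
   of index [n], with values in the ball of index [tau n]. *)
Inductive op_func : Type :=
| FIncl (b : side) (m n : nat) of (m <= n)%N
| FAdd (b : side) (m n : nat)
| FScale (b : side) (q : rat) (m n : nat) of `|q| * m.+1%:R <= n.+1%:R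
| FT (n : nat).

Definition op_fdom (f : op_func) : seq op_sort :=
  match f with
  | FIncl b m n _ => [:: (b, m)]
  | FAdd b m n => [:: (b, m); (b, n)]
  | FScale b q m n _ => [:: (b, m)]
  | FT n => [:: (Dom, n)]
  end.

(* Radii: (n + m).+2 = n.+1 + m.+1. *)
Definition op_fcod (tau : nat -> nat) (f : op_func) : op_sort :=
  match f with
  | FIncl b m n _ => (b, n)
  | FAdd b m n => (b, (m + n).+1)
  | FScale b q m n _ => (b, n)
  | FT n => (Cod, tau n)
  end.

Lemma half_gt0 (R : realType) (e : R) : 0 < e -> 0 < e / 2.
Proof. by move=> e0; rewrite divr_gt0. Qed.

Definition id_modulus (R : realType) : modulus R :=
  @Modulus R id (fun e e0 => e0).
Definition half_modulus (R : realType) : modulus R :=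
  @Modulus R (fun e => e / 2) (@half_gt0 R).

(* For the scaled metrics the vector space operations are 1-Lipschitz and the
   scaled norm is 2-Lipschitz. *)
Definition op_signature (R : realType) (tau : nat -> nat)
    (mu : nat -> modulus R) : signature R :=
  {| sort := op_sort;
     func := op_func;
     fdom := op_fdom;
     fcod := op_fcod tau;
     fmod := fun f => if f is FT n then mu n else id_modulus R;
     pred_symb := op_sort;  (* the norm on each ball *)
     pdom := fun s => [:: s];
     pmod := fun=> half_modulus R;
     cst := op_sort;  (* the origin of each ball *)
     cst_sort := id |}.

(* [T] respects the data that the signature prescribes for its symbols: target
   balls and moduli of uniform continuity. *)
Definition op_respects (R : realType) (tau : nat -> nat) (mu : nat -> modulus R)
    (X Y : normedModType R) (T : {linear X -> Y}) : Prop :=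
  forall n,
  (forall x : X, `|x| <= n.+1%:R -> `|T x| <= (tau n).+1%:R) /\
  (forall e : R, 0 < e ->
    forall x y : X, `|x| <= n.+1%:R -> `|y| <= n.+1%:R ->
    `|x - y| / (2 * n.+1%:R) < mu n e ->
    `|T x - T y| / (2 * (tau n).+1%:R) <= e).

Section OperatorStructure.
Context (R : realType) (tau : nat -> nat) (mu : nat -> modulus R).
Context (X Y : normedModType R) (T : {linear X -> Y}).
Hypothesis TS : op_respects tau mu T.

Let S := op_signature tau mu.

Definition op_space (b : side) : normedModType R := if b is Dom then X else Y.

Definition op_carrier (s : op_sort) : metricType R := sball (op_space s.1) s.2.

Lemma incl_subproof (V : normedModType R) m n (x : sball V m) :
  (m <= n)%N -> `|val x| <= n.+1%:R.
Proof. by move=> mn; rewrite (le_trans (valP x))// ler_nat ltnS. Qed.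

Lemma add_subproof (V : normedModType R) m n (x : sball V m) (y : sball V n) :
  `|val x + val y| <= (m + n).+2%:R.
Proof.
rewrite (le_trans (ler_normD _ _))//.
by rewrite -addnS -addSn natrD lerD// (valP x, valP y).
Qed.

Lemma scale_subproof (V : normedModType R) (q : rat) m n (x : sball V m) :
  `|q| * m.+1%:R <= n.+1%:R -> `|(ratr q : R) *: val x| <= n.+1%:R.
Proof.
move=> qmn; rewrite normrZ (@le_trans _ _ (`|ratr q| * m.+1%:R))//.
  by rewrite ler_wpM2l// (valP x).
by rewrite -[leRHS](ratr_nat R) -(ratr_nat R m.+1) -ratr_norm -rmorphM ler_rat.
Qed.

Lemma T_subproof n (x : sball X n) : `|T (val x)| <= (tau n).+1%:R.
Proof. exact: (TS n).1 _ (valP x). Qed.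

Lemma zero_subproof (V : normedModType R) n : `|0 : V| <= n.+1%:R.
Proof. by rewrite normr0. Qed.

Definition op_fint (f : op_func) :
    env op_carrier (op_fdom f) -> op_carrier (op_fcod tau f) :=
  match f return env op_carrier (op_fdom f) -> op_carrier (op_fcod tau f) with
  | FIncl b m n mn => fun a =>
      let x : sball (op_space b) m := a _ VZ in
      exist _ (val x) (incl_subproof x mn)
  | FAdd b m n => fun a =>
      let x : sball (op_space b) m := a _ VZ in
      let y : sball (op_space b) n := a _ (VS VZ) in
      exist _ (val x + val y) (add_subproof x y)
  | FScale b q m n qmn => fun a =>
      let x : sball (op_space b) m := a _ VZ in
      exist _ ((ratr q : R) *: val x) (scale_subproof x qmn)
  | FT n => fun a =>
      let x : sball X n := a _ VZ in
      exist _ (T (val x)) (T_subproof x)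
  end.

Definition op_pint (s : op_sort) (a : env op_carrier [:: s]) : R :=
  let x : sball (op_space s.1) s.2 := a s VZ in
  `|val x| / s.2.+1%:R.

Definition op_cint (s : op_sort) : op_carrier s :=
  exist _ 0 (zero_subproof (op_space s.1) s.2).

Lemma op_pint01 (s : op_sort) (a : env op_carrier [:: s]) :
  0 <= op_pint a <= 1.
Proof.
by rewrite divr_ge0//= ler_pdivrMr// mul1r; exact: (valP (a s VZ)).
Qed.

Lemma op_fintP (f : op_func) (e : R) : 0 < e ->
  forall a b : env op_carrier (op_fdom f),
  env_close (fmod (f : func S) e) a b -> mdist (op_fint a) (op_fint b) <= e.
Proof.
move=> e0; case: f => [s m n mn|s m n|s q m n qmn|n] a b /= ab.
- set x : sball (op_space s) m := a _ VZ; set y : sball (op_space s) m := b _ VZ.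
  have xy : `|val x - val y| / (2 * m.+1%:R) < e := ab _ VZ.
  change (`|val x - val y| / (2 * n.+1%:R) <= e).
  apply: le_trans (ltW xy); rewrite ler_wpM2l// lef_pV2 ?posrE ?mulr_gt0//.
  by rewrite ler_wpM2l// ler_nat ltnS.
- set x : sball (op_space s) m := a _ VZ; set y : sball (op_space s) m := b _ VZ.
  set z : sball (op_space s) n := a _ (VS VZ).
  set t : sball (op_space s) n := b _ (VS VZ).
  have xy : `|val x - val y| / (2 * m.+1%:R) < e := ab _ VZ.
  have zt : `|val z - val t| / (2 * n.+1%:R) < e := ab _ (VS VZ).
  change (`|(val x + val z) - (val y + val t)| / (2 * (m + n).+2%:R) <= e).
  move: xy zt; rewrite !ltr_pdivrMr ?mulr_gt0// => xy zt.
  rewrite ler_pdivrMr ?mulr_gt0// opprD addrACA (le_trans (ler_normD _ _))//.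
  by rewrite -addnS -addSn natrD mulrDr mulrDr lerD// ltW.
- set x : sball (op_space s) m := a _ VZ; set y : sball (op_space s) m := b _ VZ.
  have xy : `|val x - val y| / (2 * m.+1%:R) < e := ab _ VZ.
  change (`|(ratr q : R) *: val x - (ratr q : R) *: val y| / (2 * n.+1%:R) <= e).
  move: xy; rewrite ltr_pdivrMr ?mulr_gt0// => /ltW xy.
  rewrite -scalerBr normrZ ler_pdivrMr ?mulr_gt0//.
  rewrite (@le_trans _ _ (`|ratr q| * (e * (2 * m.+1%:R))))//.
    by rewrite ler_wpM2l.
  rewrite mulrCA ler_pM2l// mulrCA ler_pM2l//.
  by rewrite -[leRHS](ratr_nat R) -(ratr_nat R m.+1) -ratr_norm -rmorphM ler_rat.
- set x : sball X n := a _ VZ; set y : sball X n := b _ VZ.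
  exact: (TS n).2 e0 _ _ (valP x) (valP y) (ab _ VZ).
Qed.

Lemma op_pintP (s : op_sort) (e : R) : 0 < e ->
  forall a b : env op_carrier [:: s],
  env_close (half_modulus R e) a b -> `|op_pint a - op_pint b| <= e.
Proof.
case: s => s n e0 a b ab; rewrite /op_pint /=.
set x : sball (op_space s) n := a _ VZ; set y : sball (op_space s) n := b _ VZ.
have : `|val x - val y| / (2 * n.+1%:R) < e / 2 := ab _ VZ.
rewrite ltr_pdivrMr ?mulr_gt0// mulrA divfK ?pnatr_eq0// => /ltW xy.
rewrite -mulrBl normrM normfV (ger0_norm (ler0n _ _)) ler_pdivrMr//.
exact: le_trans (ler_dist_dist _ _) xy.
Qed.

Definition op_structure : structure S :=
  @Structure R S op_carrier op_fint op_pint op_cint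
    (fun s => @sdist_le1 R (op_space s.1) s.2) op_pint01 op_fintP op_pintP.

End OperatorStructure.

Definition infinite_dimensional (R : realType) (V : normedModType R) : Prop :=
  forall (n : nat) (v : 'I_n -> V),
  exists x : V, forall c : 'I_n -> R, x <> \sum_(i < n) c i *: v i.

Definition bounded_operator (R : realType) (X Y : normedModType R)
    (T : {linear X -> Y}) : Prop :=
  exists C : R, forall x, `|T x| <= C * `|x|.

(* The cardinality of [D] is the density of [V]. *)
Definition least_dense (V : topologicalType) (D : set V) : Prop :=
  dense D /\ forall E : set V, dense E -> D #<= E.

Definition density_lt (V W : topologicalType) : Prop :=
  exists (D : set V) (E : set W),
    [/\ least_dense D, least_dense E, D #<= E & ~ (E #<= D)].

Definition separable (V : topologicalType) : Prop :=
  exists2 D : set V, countable D & dense D.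

(* The least uncountable cardinality. *)
Definition card_aleph1 (U : Type) (A : set U) : Prop :=
  ~ countable A /\
  forall (U' : Type) (B : set U'), ~ countable B -> A #<= B.

Definition density_aleph1 (V : topologicalType) : Prop :=
  exists2 D : set V, least_dense D & card_aleph1 D.

(* Main.v *)
(* Idea.  Call a subset of [X] small when it is covered by as many unit balls
   as [Y] has density; since the square of an infinite cardinal is itself,
   small sets form an ideal closed under unions of that size, and [X] is not
   small.  On the power of [X] indexed by omega_1 one builds, by recursion along
   omega_1, an ultrafilter that is generic for the iterated quantifier "for all
   [x] outside a small set": by completeness of the ideal, each of countably many
   given functions from finite tuples of coordinates to a set of size
   density([Y]) becomes constant almost everywhere, with a value in a fixed
   countable set, while the coordinates stay at distance 1 from each other.
   The functions of finitely many coordinates built from countably many Skolem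
   functions for [L] are then the names of the elements of dense subsets of [X']
   and [Y'], which are separated reduced powers.  Constancy almost everywhere
   gives the transfer of countable suprema and the separability of [Y'];
   continuity of the fragment transfers suprema over the completion from the
   dense set of names.  Surjectivity is preserved because the open mapping
   theorem yields a bounded (nonlinear) section of [T], used as a Skolem
   function. *)

From HB Require Import structures.
Require Import Defs.
From mathcomp Require Import all_boot all_order all_algebra.
From mathcomp Require Import all_classical all_reals.
From mathcomp Require Import interval_inference topology normedtype sequences.
From mathcomp Require Import lra.
From mathcomp Require wochoice.

Set Implicit Arguments.
Unset Strict Implicit.
Unset Printing Implicit Defensive.

Local Open Scope classical_set_scope.
Local Open Scope card_scope.

(** * Infinite cardinals *)

(** A full ultrapower would not do: in general it fails to preserve countable suprema and its
    codomain is not separable. Both defects concern choices that the ultrafilter must settle: an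
    index at which one of countably many formulas exceeds a rational threshold, or a nearby point of
    a dense subset of the codomain. Each such choice is written as a function into one set [Lam],
    and the ultrafilter is built so as to make it constant. The obstacle is that a choice depends on
    several coordinates at once. The last one is eliminated by [dom]: a value taken on many
    extensions of a tuple is again a function of the shorter tuple. A countable family closed under
    this operation can be decided one coordinate at a time, down to the empty tuple, where only
    countably many values are left. The index set omega_1 serves twice. Below each index there are
    only countably many requirements, so one sequence of conditions meets them all; and countably
    many operations on omega_1 coordinates produce no more names than any uncountable set has
    elements. *)

Lemma sval_inj (T : Type) (P : T -> Prop) : injective (@sval T P).
Proof. by move=> [x Px] [y Py] /= xy; exact: eq_exist. Qed.

Lemma Zorn_above (T : Type) (P : set (set T)) (A0 : set T) :
  P A0 ->
  (forall F : set (set T), F !=set0 -> F `<=` P -> total_on F subset ->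
    P (\bigcup_(X in F) X)) ->
  exists A, [/\ A0 `<=` A, P A & forall B, A `<=` B -> P B -> B `<=` A].
Proof.
move=> PA0 chainP.
have [F FP Ftot|A [PA Amax]] := @Zorn_bigcup T [set A | P (A0 `|` A)].
  have [->|/set0P[X0 FX0]] := eqVneq F set0.
    by rewrite /= bigcup_set0 setU0.
  change (P (A0 `|` \bigcup_(X in F) X)).
  have -> : A0 `|` \bigcup_(X in F) X =
      \bigcup_(Y in [set A0 `|` X | X in F]) Y.
    apply/seteqP; split=> [x [A0x|[X FX Xx]]|x [_ [X FX <-] [A0x|Xx]]].
    - by exists (A0 `|` X0); [exists X0|left].
    - by exists (A0 `|` X); [exists X|right].
    - by left.
    - by right; exists X.
  apply: chainP.
  - by exists (A0 `|` X0), X0.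
  - by move=> _ [X FX <-]; exact: FP.
  - move=> _ _ [X FX <-] [Y FY <-].
    by have [XY|YX] := Ftot _ _ FX FY; [left|right]; exact: setUS.
exists (A0 `|` A); split => // B AB PB.
have A0B : A0 `<=` B by apply: subset_trans AB.
have AsB : A `<=` B by apply: subset_trans AB.
apply: contrapT => BA; apply: (Amax B); last by rewrite /= setUidr.
by split=> // BA'; apply: BA; apply: subset_trans BA' _.
Qed.

Lemma total_bigcup2 (T : Type) (F : set (set T)) (p q : T) :
  total_on F subset -> (\bigcup_(X in F) X) p -> (\bigcup_(X in F) X) q ->
  exists X, [/\ F X, X p & X q].
Proof.
move=> Ftot [X FX Xp] [Y FY Yq]; have [XY|YX] := Ftot _ _ FX FY.
  by exists Y; split=> //; exact: XY.
by exists X; split=> //; exact: YX.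
Qed.

(** A maximal partial injection is total or surjective, as otherwise one more pair could be
    added. *)
Lemma injective_total (T U : Type) :
  (exists f : T -> U, injective f) \/ (exists g : U -> T, injective g).
Proof.
pose P (G : set (T * U)) := (forall x y y', G (x, y) -> G (x, y') -> y = y') /\
  (forall x x' y, G (x, y) -> G (x', y) -> x = x').
have [F FP Ftot|G [[Gfun Ginj] Gmax]] := @Zorn_bigcup _ P.
  have two p q := total_bigcup2 (p := p) (q := q) Ftot.
  split=> [x y y' xy xy'|x x' y xy x'y].
    by have [X [/FP[Xf _] Xp Xq]] := two _ _ xy xy'; exact: Xf Xp Xq.
  by have [X [/FP[_ Xi] Xp Xq]] := two _ _ xy x'y; exact: Xi Xp Xq.
have [Gtot|/existsNP[x0 /forallNP Gx0]] := pselect (forall x, exists y, G (x, y)).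
  left; have [f fG] := choice Gtot; exists f => x x' ffx.
  by apply: (Ginj _ _ (f x)) => //; rewrite ffx.
have [Gsur|/existsNP[y0 /forallNP Gy0]] := pselect (forall y, exists x, G (x, y)).
  right; have [g gG] := choice Gsur; exists g => y y' ggy.
  by apply: (Gfun (g y)) => //; rewrite ggy.
exfalso; have GG' : G `<` ((x0, y0) |` G).
  by split=> [|sub]; [exact: subsetUr|apply/(Gx0 y0)/sub; left].
apply: (Gmax _ GG'); split=> [x y y'|x x' y].
  case=> [[-> ->]|xy]; case=> [[]|xy'] //; first by move: xy' => /Gx0.
    by move=> xx0; move: xy; rewrite xx0 => /Gx0.
  exact: Gfun xy xy'.
case=> [[-> ->]|xy]; case=> [[]|xy'] //; first by move: xy' => /Gy0.
  by move=> _ yy0; move: xy; rewrite yy0 => /Gy0.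
exact: Ginj xy xy'.
Qed.

(** * The square of an infinite set *)

Section Square.
Variables (T : Type) (e : nat -> T).
Hypothesis e_inj : injective e.

(** The base set is read off the diagonal, so that one set of triples carries both a set and an
    injection of its square into itself. *)
Let fld (G : set (T * T * T)) x := exists z, G (x, x, z).

Let square (G : set (T * T * T)) :=
  [/\ forall p z z', G (p, z) -> G (p, z') -> z = z',
      forall p p' z, G (p, z) -> G (p', z) -> p = p',
      forall x y, fld G x -> fld G y -> exists2 z, fld G z & G (x, y, z) &
      forall x y z, G (x, y, z) -> fld G x /\ fld G y].

Let square_chain (F : set (set (T * T * T))) : F `<=` square ->
  total_on F subset -> square (\bigcup_(X in F) X).
Proof.
move=> FP Ftot.
have fldS X Y x : X `<=` Y -> fld X x -> fld Y x.
  by move=> XY [z Xz]; exists z; exact: XY.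
have two p q := total_bigcup2 (p := p) (q := q) Ftot.
split.
- move=> p z z' pz pz'.
  by have [X [/FP[Xf _ _ _] Xp Xq]] := two _ _ pz pz'; exact: Xf Xp Xq.
- move=> p p' z pz pz'.
  by have [X [/FP[_ Xi _ _] Xp Xq]] := two _ _ pz pz'; exact: Xi Xp Xq.
- move=> x y [u xu] [v yv].
  have [X [FX Xp Xq]] := two _ _ xu yv.
  have [_ _ Xtot _] := FP _ FX.
  have [z Xz Xxyz] := Xtot _ _ (ex_intro _ u Xp) (ex_intro _ v Xq).
  by exists z; [apply: fldS Xz; exact: bigcup_sup|exists X].
- move=> x y z [X FX]; have [_ _ _ Xfld] := FP _ FX => /Xfld[Xx Xy].
  by split; [apply: fldS Xx|apply: fldS Xy]; exact: bigcup_sup.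
Qed.

Let G0 : set (T * T * T) :=
  [set q | exists m n, q = (e m, e n, e (pickle (m, n)))].

Let fldG0 x : fld G0 x -> exists n, x = e n.
Proof. by move=> [z [m [n [-> _ _]]]]; exists m. Qed.

Let fldG0e n : fld G0 (e n).
Proof. by exists (e (pickle (n, n))), n, n. Qed.

Let square_G0 : square G0.
Proof.
split.
- move=> _ z z' [m [n [-> ->]]] [m' [n' []]].
  by move=> /e_inj -> /e_inj -> ->.
- move=> _ _ z [m [n [-> ->]]] [m' [n' [-> +]]].
  by move=> /e_inj /(pcan_inj pickleK)[-> ->].
- move=> _ _ /fldG0[m ->] /fldG0[n ->].
  by exists (e (pickle (m, n))); [exact: fldG0e|exists m, n].
- by move=> x y z [m [n [-> -> _]]].
Qed.

(** Let [B] be the base of a maximal injection of a square into its base. If the complement of [B]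
    embeds in [B], then [T] embeds in two copies of [B], hence in [B]. Otherwise [B] has a copy
    outside itself, onto which the injection extends, against maximality. *)
Lemma infinite_square : exists f : T * T -> T, injective f.
Proof.
have [G [G0G [Gfun Ginj Gtot Gfld] Gmax]] :=
  Zorn_above square_G0 (fun F _ => @square_chain F).
pose B := fld G.
have Be n : B (e n) by have [z G0z] := fldG0e n; exists z; exact: G0G.
have Gtot' (p : T * T) : exists z, B p.1 -> B p.2 -> B z /\ G (p, z).
  have [[Bx By]|nB] := pselect (B p.1 /\ B p.2); last first.
    by exists p.1 => Bx By; case: nB.
  have [z Bz Gz] := Gtot _ _ Bx By.
  by exists z => _ _; split=> //; rewrite [p]surjective_pairing.
have [f0 f0P] := choice Gtot'.
pose f x y := f0 (x, y).
have fB x y : B x -> B y -> B (f x y) by move=> Bx By; apply: (f0P (x, y) _ _).1.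
have fG x y : B x -> B y -> G (x, y, f x y).
  by move=> Bx By; apply: (f0P (x, y) _ _).2.
have finj x y x' y' : B x -> B y -> B x' -> B y' -> f x y = f x' y' ->
    x = x' /\ y = y'.
  move=> Bx By Bx' By' ff; have := fG _ _ Bx' By'; rewrite -ff.
  by move=> /(Ginj _ _ _ (fG _ _ Bx By))[-> ->].
have [[j jinj]|[g ginj]] := injective_total {x | B x} {x | ~ B x}; last first.
  (* The tags [e 0] and [e 1] keep the two copies of [B] apart inside [B]. *)
  pose h x := if pselect (B x) is right nB then f (e 1) (sval (g (exist _ x nB)))
              else f (e 0) x.
  have gB z : B (sval (g z)) by case: (g z).
  have hB x : B (h x) by rewrite /h; case: pselect => Bx; apply: fB.
  have hinj : injective h.
    move=> x y; rewrite /h; case: pselect => Bx; case: pselect => By.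
    - by move=> /finj[].
    - by move=> /finj[]// /e_inj.
    - by move=> /finj[]// /e_inj.
    - have := gB (exist _ x Bx); have := gB (exist _ y By).
      by move=> B1 B2 /finj[]// _ /sval_inj /ginj[].
  by exists (fun p => f (h p.1) (h p.2)) => -[x y] [x' y'] /= /finj[]// /hinj-> /hinj->.
pose j' x := if pselect (B x) is left Bx then sval (j (exist _ x Bx)) else x.
have j'B x : B x -> ~ B (j' x).
  by move=> Bx; rewrite /j'; case: pselect => // Bx'; case: (j _).
have j'inj x y : B x -> B y -> j' x = j' y -> x = y.
  move=> Bx By; rewrite /j'; case: pselect => // Bx'; case: pselect => // By'.
  by move=> /sval_inj/jinj/(congr1 sval).
(* With B' the image of [B] under [j'], the pairs still without a value form three blocks: B' x B, B
   x B' and B' x B'. Block [k] is sent into B' with the tag [e k]. *)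
pose u (k : nat) b c := if k is 0 then (j' b, c)
  else if k is 1 then (b, j' c) else (j' b, j' c).
pose G' := G `|` [set q | exists k b c, [/\ (k < 3)%N, B b, B c &
  q = (u k b c, j' (f (e k) (f b c)))]].
have fldG' x : fld G' x <-> B x \/ exists2 b, B b & x = j' b.
  split.
    move=> [z [Gz|[k [b [c [k3 Bb Bc]]]]]]; first by left; exists z.
    case: k k3 => [|[|[|//]]] _.
    - by case=> -> _ _; right; exists b.
    - by case=> _ -> _; right; exists c.
    - by case=> _ -> _; right; exists c.
  move=> [[z Gz]|[b Bb ->]]; first by exists z; left.
  by exists (j' (f (e 2) (f b b))); right; exists 2, b, b.
have j'B' x b : x = j' b -> B x -> B b -> False.
  by move=> xE Bx Bb; apply: (j'B b) => //; rewrite -xE.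
have uB k b c x y : u k b c = (x, y) -> B b -> B c -> B x -> B y -> False.
  move=> uE Bb Bc Bx By; case: k uE => [|[|k]] /= [].
  - by move=> /esym/j'B'[].
  - by move=> _ /esym/j'B'[].
  - by move=> /esym/j'B'[].
have G'fld x y z : G (x, y, z) -> [/\ B x, B y & B z].
  move=> Gxyz; have [Bx By] := Gfld _ _ _ Gxyz; split=> //.
  by rewrite (Gfun _ _ _ Gxyz (fG _ _ Bx By)); exact: fB.
have uinj k k' b c b' c' : u k b c = u k' b' c' -> (k < 3)%N -> (k' < 3)%N ->
    B b -> B c -> B b' -> B c' -> [/\ k = k', b = b' & c = c'].
  move=> uE k3 k'3 Bb Bc Bb' Bc'; move: uE.
  case: k k3 => [|[|[|//]]] _; case: k' k'3 => [|[|[|//]]] _ /= [];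
    first 
    [by move=> /j'inj-> // /j'inj -> | by move=> /j'inj-> // ->
    | by move=> -> /j'inj -> | by move=> ? /j'B'[] | by move=> ? /esym/j'B'[]
    | by move=> /j'B'[] | by move=> /esym/j'B'[]].
have Bk i b c : B b -> B c -> B (f (e i) (f b c)).
  by move=> Bb Bc; exact: fB (Be i) (fB _ _ Bb Bc).
have GG' : G `<=` G' by exact: subsetUl.
have : G' `<=` G.
  apply: Gmax => //.
  split.
  - move=> [x y] z z' [Gz|[k [b [c [k3 Bb Bc [xyE ->]]]]]].
      have [Bx By _] := G'fld _ _ _ Gz.
      move=> [|[k [b [c [k3 Bb Bc [/esym/uB[]//]]]]]].
      exact: Gfun Gz.
    move=> [/G'fld[Bx By _]|]; first by move: xyE => /esym/uB[].
    move=> [k' [b' [c' [k'3 Bb' Bc' [+ ->]]]]]; rewrite xyE => /uinj.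
    by case/(_ k3 k'3 Bb Bc Bb' Bc') => -> -> ->.
  - move=> [x y] [x' y'] z [Gz|[k [b [c [k3 Bb Bc [-> ->]]]]]].
      have [_ _ Bz] := G'fld _ _ _ Gz.
      move=> [|[k [b [c [k3 Bb Bc [_ zE]]]]]]; first exact: Ginj Gz.
      by case: (j'B' _ _ zE Bz (Bk _ _ _ Bb Bc)).
    move=> [/G'fld[_ _ /(j'B _ (Bk _ _ _ Bb Bc))//]|].
    move=> [k' [b' [c' [k'3 Bb' Bc' [-> /j'inj]]]]].
    case/(_ (Bk _ _ _ Bb Bc) (Bk _ _ _ Bb' Bc'))/finj => //; try exact: fB.
    by move=> /e_inj -> /finj[]// -> ->.
  - have new k b c : (k < 3)%N -> B b -> B c ->
        exists2 z, fld G' z & G' (u k b c, z).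
      move=> k3 Bb Bc; exists (j' (f (e k) (f b c))).
        by apply/fldG'; right; exists (f (e k) (f b c)) => //; exact: Bk.
      by right; exists k, b, c.
    move=> x y /fldG'[Bx|[b Bb ->]] /fldG'[By|[c Bc ->]].
    + by exists (f x y); [apply/fldG'; left; exact: fB|left; exact: fG].
    + exact: (new 1 x c).
    + exact: (new 0 b y).
    + exact: (new 2 b c).
  - move=> x y z [/G'fld[Bx By _]|]; first by split; apply/fldG'; left.
    move=> [k [b [c [k3 Bb Bc]]]]; case: k k3 => [|[|[|//]]] _ [-> -> _];
      split; apply/fldG'; by [left|right; exists b|right; exists c].
pose z := j' (f (e 2) (f (e 0) (e 0))).
move=> /(_ (u 2 (e 0) (e 0), z)) G'G.
case: (G'fld (j' (e 0)) (j' (e 0)) z) => [|/(j'B _ (Be 0))]//; apply: G'G.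
by right; exists 2, (e 0), (e 0).
Qed.
End Square.

Lemma card_le_inj (T U : Type) (A : set T) (B : set U) :
  A #<= B -> A !=set0 -> exists f : T -> U, set_fun A B f /\ set_inj A f.
Proof.
move=> /card_leP[f] [a /mem_set Aa].
exists (fun x => val (f (insubd (exist _ a Aa : A) x))); split.
  by move=> x _; exact: set_valP.
move=> x y /[dup] Ax _ /[dup] Ay _ /val_inj /inj.
by rewrite !inE => /(_ I I)/(congr1 val); rewrite !val_insubd Ax Ay.
Qed.

Lemma card_le_of_inj (T U : Type) (A : set T) (B : set U) (f : T -> U) :
  set_fun A B f -> set_inj A f -> A #<= B.
Proof.
move=> fAB finj; have /injfunPex[g] : exists2 f, set_fun A B f & set_inj A f.
  by exists f.
exact: inj_card_le.
Qed.

Lemma countable_enum (T : Type) (x0 : T) (A : set T) : countable A ->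
  exists e : nat -> T, A `<=` range e.
Proof.
move=> cA; have [->|/set0P A0] := eqVneq A set0; first by exists (fun=> x0).
have /countable_injP[f finj] := cA.
exists (fun n => if pselect (exists2 x, A x & f x = n) is left h then
  sval (cid2 h) else x0) => x Ax; exists (f x) => //.
case: pselect => [h|[]]; last by exists x.
by case: (cid2 h) => y /= Ay fyx; apply: finj; rewrite ?inE.
Qed.

Lemma uncountable_set_nat : ~ countable [set: set nat].
Proof.
move=> /countable_injP[f finj].
pose D n := exists2 A : set nat, f A = n & ~ A n.
have [DD|DD] := pselect (D (f D)); last by apply: (DD); exists D.
case: (DD) => A /finj fAD; apply.
by rewrite fAD// inE.
Qed.

(** * A well-order of type omega_1 *)

Definition omega1_order (W : Type) (lt : W -> W -> Prop) : Prop :=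
  [/\ well_founded lt, forall x y z, lt x y -> lt y z -> lt x z,
      forall x y, [\/ lt x y, x = y | lt y x],
      forall x, countable [set y | lt y x] & ~ countable [set: W]].

(** A well-order of the power set of [nat] is cut down to the elements with countably many
    predecessors. Were there only countably many of these, some element would lie outside, and the
    least such element would have countably many predecessors after all. *)
Lemma omega1_exists : exists (W : choiceType) (lt : W -> W -> Prop), omega1_order lt.
Proof.
pose T := {classic set nat}.
have [R Rwo] := wochoice.well_ordering_principle T.
have min (A : set T) : A !=set0 -> exists2 z, A z & forall x, A x -> R z x.
  move=> [x Ax].
  case: (Rwo (fun x => x \in A)); first by exists x; rewrite unfold_in inE.
  move=> z [[zA zmin] _]; exists z; first by move: zA; rewrite unfold_in inE.
  by move=> y Ay; apply: zmin; rewrite unfold_in inE.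
have Rtot x y : R x y \/ R y x.
  have [z [->|->] zmin] := min [set x; y] (ex_intro _ x (or_introl erefl)).
    by left; apply: zmin; right.
  by right; apply: zmin; left.
have Ranti x y : R x y -> R y x -> x = y.
  move=> xy yx; case: (Rwo (fun z => z \in [set x; y])).
    by exists x; rewrite unfold_in inE; left.
  have [xx yy] : R x x /\ R y y by split; [case: (Rtot x x)|case: (Rtot y y)].
  move=> z [_ zuniq]; rewrite -(zuniq x); last first.
    split; first by rewrite unfold_in inE; left.
    by move=> t; rewrite unfold_in inE => -[->|->].
  apply: zuniq; split; first by rewrite unfold_in inE; right.
  by move=> t; rewrite unfold_in inE => -[->|->].
have Rtrans x y z : R x y -> R y z -> R x z.
  move=> xy yz.
  have [t + tmin] := min [set x; y; z] (ex_intro _ x (or_introl (or_introl erefl))).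
  have tx : R t x by apply: tmin; left; left.
  have ty : R t y by apply: tmin; left; right.
  have tz : R t z by apply: tmin; right.
  case=> [[tE|tE]|tE]; rewrite {}tE {tmin} in tx ty tz => //.
    by rewrite (Ranti _ _ xy tx).
  by rewrite -(Ranti _ _ yz ty).
pose lt x y := R x y /\ x <> y.
have lttrans x y z : lt x y -> lt y z -> lt x z.
  move=> [xy nxy] [yz nyz]; split; first exact: Rtrans xy yz.
  by move=> xz; subst z; apply: nxy; exact: Ranti.
have lttot x y : [\/ lt x y, x = y | lt y x].
  have [->|nxy] := pselect (x = y); first by constructor 2.
  by case: (Rtot x y) => ?; [constructor 1|constructor 3]; split => // /esym.
have wf : well_founded lt.
  move=> x; apply: contrapT => nx.
  have [z nz zmin] := min [set x | ~ Acc lt x] (ex_intro _ x nx).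
  apply: nz; constructor => y [yz nyz]; apply: contrapT => /zmin zy.
  by apply: nyz; exact: Ranti.
pose A := [set x | countable [set y | lt y x]].
exists {classic {x | A x}}, (fun x y => lt (sval x) (sval y)); split.
- move=> [x]; elim/(well_founded_ind wf): x => x IH Ax.
  by constructor => -[y Ay] /= yx; exact: IH.
- by move=> x y z; exact: lttrans.
- move=> x y; case: (lttot (sval x) (sval y)) => ?; first by constructor 1.
    by constructor 2; exact: sval_inj.
  by constructor 3.
- move=> [x Ax] /=; apply: card_le_trans Ax.
  by apply: (@card_le_of_inj _ _ _ _ sval) => // y z _ _; exact: sval_inj.
- move=> cA; have {}cA : countable A.
    apply: card_le_trans cA; have [->|/set0P[a Aa]] := eqVneq A set0; first by [].
    apply: (@card_le_of_inj _ _ _ _ (fun x => if pselect (A x) is left Ax then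
      exist _ x Ax else exist _ a Aa)) => // x y; rewrite !inE => Ax Ay.
    by do 2![case: pselect => // ?]; move=> /(congr1 sval).
  have [AT|/existsNP nAT] := pselect (forall x, A x).
    by apply: uncountable_set_nat; apply: card_le_trans cA; apply: subset_card_le.
  have [m nAm mmin] := min (~` A) nAT.
  apply: nAm; apply: (sub_countable _ cA); apply: subset_card_le => y [ym nym].
  by apply: contrapT => /mmin my; apply: nym; exact: Ranti.
Qed.

Section Omega1.
Variables (W : Type) (lt : W -> W -> Prop).
Hypothesis W_omega1 : omega1_order lt.

Lemma omega1_min (A : set W) : A !=set0 ->
  exists2 z, A z & forall x, A x -> z = x \/ lt z x.
Proof.
move=> [x Ax]; apply: contrapT => nA.
have [wf _ tot _ _] := W_omega1.
elim/(well_founded_ind wf): x Ax => x IH Ax; apply: nA; exists x => // y Ay.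
by case: (tot x y) => [||/IH]; [right|left|].
Qed.

Lemma omega1_irr x : ~ lt x x.
Proof.
have [wf _ _ _ _] := W_omega1.
by move: x; apply: (well_founded_ind wf) => x IH xx; exact: (IH x xx).
Qed.

(* An uncountable set contains an infinite sequence that avoids any countable
   set; these sequences are chosen by recursion on [W]. *)
Lemma omega1_card_le (U : Type) (B : set U) : ~ countable B ->
  [set: W * nat] #<= B.
Proof.
move=> nB; have [wf _ tot cseg _] := W_omega1.
have [u Bu] : B !=set0.
  by apply/set0P/negP => /eqP B0; apply: nB; rewrite B0.
pose good x (rec : forall y, lt y x -> nat -> U) :=
  [set g : nat -> U | injective g /\ forall n, B (g n) /\
    forall y (yx : lt y x) m, rec y yx m <> g n].
pose F x rec := if pselect (good x rec !=set0) is left h then sval (cid h)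
                else fun=> u.
pose f := Fix wf (fun=> nat -> U) F.
have fE x : f x = F x (fun y _ => f y).
  apply: Fix_eq => {}x r r' rr'; congr (F x _).
  by apply: functional_extensionality_dep => y; apply: functional_extensionality_dep.
have fP x : good x (fun y _ => f y) (f x).
  rewrite fE /F; case: pselect => [h|[]]; first exact: svalP.
  pose A := \bigcup_(y in [set y | lt y x]) range (f y).
  have cA : countable A.
    by apply: bigcup_countable => // y _; apply: card_image_le.
  have : infinite_set (B `\` A).
    move=> /finite_set_countable cBA; apply: nB.
    apply: (@sub_countable _ _ _ (A `|` (B `\` A))).
      by apply: subset_card_le => b Bb; have [|] := pselect (A b); [left|right].
    rewrite -bigcup2E; apply: bigcup_countable => // -[|[|i]] _ //=.
  move=> /infiniteP /card_le_inj[|g [gB ginj]]; first by exists 0.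
  exists g; split; first by move=> m n; apply: ginj; rewrite inE.
  move=> n; have [Bg nAg] := gB n I; split=> // y yx m fg.
  by apply: nAg; exists y => //; exists m.
apply: (@card_le_of_inj _ _ _ _ (fun p => f p.1 p.2)).
  by move=> [x n] _; exact: ((fP x).2 n).1.
move=> [x m] [y n] _ _ /= fxy; case: (tot x y) => xy.
- by case: (((fP y).2 n).2 x xy m).
- by move: fxy; rewrite -xy => /(fP x).1 ->.
- by case: (((fP x).2 m).2 y xy n).
Qed.

End Omega1.

(** * A generic ultrafilter on a power indexed by omega_1 *)

(** Finite trees keep names syntactic, so that they can be counted and their coordinates renamed.
    Binary nodes suffice because several arguments are later packed into one list. *)
Inductive tm (V : Type) := Leaf of V | Node of nat & tm V & tm V.

Fixpoint tm_eval (V Z : Type) (op : nat -> Z -> Z -> Z) (v : V -> Z) (t : tm V) : Z :=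
  match t with
  | Leaf x => v x
  | Node k t1 t2 => op k (tm_eval op v t1) (tm_eval op v t2)
  end.

Fixpoint tm_map (V V' : Type) (f : V -> V') (t : tm V) : tm V' :=
  match t with
  | Leaf x => Leaf (f x)
  | Node k t1 t2 => Node k (tm_map f t1) (tm_map f t2)
  end.

Fixpoint tm_leaves (V : Type) (t : tm V) : seq V :=
  match t with
  | Leaf x => [:: x]
  | Node _ t1 t2 => tm_leaves t1 ++ tm_leaves t2
  end.

Lemma tm_eval_map (V V' Z : Type) op (v : V' -> Z) (f : V -> V') t :
  tm_eval op v (tm_map f t) = tm_eval op (v \o f) t.
Proof. by elim: t => //= k t1 -> t2 ->. Qed.

Lemma countable_tm : countable [set: tm nat].
Proof.
pose enc := fix enc (t : tm nat) : GenTree.tree nat := match t with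
  | Leaf x => GenTree.Leaf x
  | Node k t1 t2 => GenTree.Node k [:: enc t1; enc t2] end.
have enc_inj : injective enc.
  by elim=> [x|k t1 IH1 t2 IH2] [y|k' t1' t2'] //= [] => [->|-> /IH1 -> /IH2 ->].
apply/countable_injP; exists (fun t => pickle (enc t)).
by move=> t t' _ _ /(pcan_inj pickleK) /enc_inj.
Qed.

Lemma countable_closure (Z : Type) (A0 : set Z) (op : nat -> Z -> Z -> Z) :
  countable A0 -> exists A, [/\ countable A, A0 `<=` A &
    forall k a b, A a -> A b -> A (op k a b)].
Proof.
move=> cA0; have [->|/set0P[z0 _]] := eqVneq A0 set0; first by exists set0; split.
have [e Ae] := countable_enum z0 cA0.
exists (range (tm_eval op e)); split.
- by apply: card_le_trans countable_tm; exact: card_image_le.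
- by move=> z /Ae[n _ <-]; exists (Leaf n).
- by move=> k _ _ [t1 _ <-] [t2 _ <-]; exists (Node k t1 t2).
Qed.

Section Generic.
Variables (K L : Type) (W : eqType) (lt : W -> W -> Prop).
Hypothesis W_omega1 : omega1_order lt.
Variable small : set (set K).
Hypothesis small_sub : forall A B, A `<=` B -> small B -> small A.
Hypothesis small_bigcup : forall F : L -> set K,
  (forall d, small (F d)) -> small (\bigcup_d F d).
Hypothesis smallT : ~ small setT.
Variable near : K -> K -> Prop.
Hypothesis small_near : forall x, small [set y | near x y].
Variable k0 : K.
Variables tt ff : L.
Hypothesis ttff : tt <> ff.

Let Om := W -> K.

Let ite (P : Prop) (a b : L) : L := if pselect P is left _ then a else b.

Let iteT P a b : P -> ite P a b = a.
Proof. by rewrite /ite; case: pselect. Qed.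

Let iteF P a b : ~ P -> ite P a b = b.
Proof. by rewrite /ite; case: pselect. Qed.

Let ite_tt P : ite P tt ff = tt -> P.
Proof. by rewrite /ite; case: pselect => // _ /esym/ttff. Qed.

Let most (e : seq K -> L) l := ~ small [set y | e (rcons l y) = tt].

Let reindex (idx : seq nat) (g : seq K -> L) (l : seq K) := g (map (nth k0 l) idx).

(* If most extensions of [l] satisfy the condition [e], then by completeness of
   the ideal there is a value [d] such that most extensions of [l] satisfy [e]
   and give [g] the value [d]. *)
Let dom_ex (g e : seq K -> L) l : exists d, most e l ->
  ~ small [set y | e (rcons l y) = tt /\ g (rcons l y) = d].
Proof.
apply: contrapT => /forallNP nd.
have sm d : small [set y | e (rcons l y) = tt /\ g (rcons l y) = d].
  by apply: contrapT => nsm; apply: (nd d).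
have me : most e l by apply: contrapT => nme; apply: (nd tt).
by apply: me; apply: small_sub (small_bigcup sm) => y ey; exists (g (rcons l y)).
Qed.

Let dom g e l := sval (cid (dom_ex g e l)).

(** All operations are put in one sequence of binary ones, as [countable_closure] requires.
    Operation 1 compares with [g2 [::]]: the value at the empty tuple is how a member of the family
    stands for a constant. *)
Let op (k : nat) (g1 g2 : seq K -> L) : seq K -> L :=
  match k with
  | 0 => fun l => ite (g1 l = tt /\ g2 l = tt) tt ff
  | 1 => fun l => ite (g1 l = g2 [::]) tt ff
  | 2 => dom g1 g2
  | 3 => fun l => ite (most g1 l) tt ff
  | k.+4 => reindex (odflt [::] (unpickle k)) g1
  end.

Let far (l : seq K) := ite (near (nth k0 l 0) (nth k0 l 1)) ff tt.

Section Closed.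
Variable G : set (seq K -> L).
Hypothesis countable_G : countable G.
Hypothesis G_far : G far.
Hypothesis G_tt : G (fun=> tt).
Hypothesis G_op : forall k g1 g2, G g1 -> G g2 -> G (op k g1 g2).

Let reindex_index (g : seq K -> L) (u v : seq W) (w : Om) : {subset u <= v} ->
  reindex (map (index^~ v) u) g (map w v) = g (map w u).
Proof.
move=> uv; rewrite /reindex -map_comp; congr g; apply/eq_in_map => x xu /=.
by rewrite (nth_map x) ?index_mem ?uv// nth_index ?uv.
Qed.

Let G_reindex g idx : G g -> G (reindex idx g).
Proof. by move=> Gg; have := G_op (pickle idx).+4 Gg Gg; rewrite /op pickleK. Qed.

(* [C] generates a filter, whose members depend only on the coordinates in the
   initial segment [I], that decides the values of the functions in [G] on [I]. *)
Let generic (I : set W) (C : set (set Om)) : Prop :=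
  [/\ forall i j, I j -> lt i j -> I i,
      [/\ C !=set0, forall A B, C A -> C B -> C (A `&` B) & forall A, C A -> A !=set0],
      forall A, C A -> forall w w' : Om, (forall i, I i -> w i = w' i) -> A w -> A w',
      forall g s, G g -> (forall i, i \in s -> I i) ->
        exists2 g0, G g0 & exists2 A, C A & A `<=` [set w | g (map w s) = g0 [::]] &
      forall i j, I j -> lt i j ->
        exists2 A, C A & A `<=` [set w : Om | ~ near (w i) (w j)]].

Section Extension.
Variables (I : set W) (C : set (set Om)) (al : W).
Hypothesis IC : generic I C.
Hypothesis I_countable : countable I.
Hypothesis alI : ~ I al.
Hypothesis Ial : forall i, lt i al -> I i.

(** A pair [(e, u)] promises that [e] holds at the coordinates [u] followed by the new coordinate
    [al]. It is a condition when [C] guarantees that the values at [al] keeping the promise do not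
    form a small set. *)
Let cond (p : (seq K -> L) * seq W) : Prop :=
  [/\ G p.1, forall i, i \in p.2 -> I i &
      exists2 A, C A & A `<=` [set w | most p.1 (map w p.2)]].

Let cyl (p : (seq K -> L) * seq W) : set Om :=
  [set w | p.1 (map w (rcons p.2 al)) = tt].

Let upd (w : Om) (y : K) : Om := fun i => if i == al then y else w i.

Let map_upd (w : Om) y s : (forall i, i \in s -> I i) -> map (upd w y) s = map w s.
Proof.
move=> sI; apply/eq_in_map => i /sI Ii; rewrite /upd; case: eqP => // ial.
by case: alI; rewrite -ial.
Qed.

Let map_upd_rcons (w : Om) y s : (forall i, i \in s -> I i) ->
  map (upd w y) (rcons s al) = rcons (map w s) y.
Proof. by move=> sI; rewrite map_rcons map_upd// /upd eqxx. Qed.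

(** The function [dom g1 e1] proposes a value of [g1] compatible with the condition and depends on
    coordinates in [I] only, so [C] has already decided it. Adding the equation between [g1] and
    this constant to the condition leaves a set that is not small. *)
Let cond_step p g s : cond p -> G g -> (forall i, i \in s -> I i \/ i = al) ->
  exists p', [/\ cond p', cyl p' `<=` cyl p &
    exists2 g0, G g0 & cyl p' `<=` [set w | g (map w s) = g0 [::]]].
Proof.
case: IC => _ [_ CI _] _ dec _.
case: p => e u [/= Ge uI [A CA Ae]] Gg sI.
pose v := u ++ [seq i <- s | i != al].
have vI i : i \in v -> I i.
  rewrite mem_cat => /orP[/uI//|]; rewrite mem_filter => /andP[+ /sI].
  by move=> /[swap] -[//|->]; rewrite eqxx.
have us : {subset rcons u al <= rcons v al}.
  move=> i; rewrite !mem_rcons !inE mem_cat => /orP[->//|->].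
  by rewrite orbT.
have ss : {subset s <= rcons v al}.
  by move=> i si; rewrite mem_rcons inE mem_cat mem_filter si andbT; case: eqP; rewrite ?orbT.
(* Both [e] and [g] are turned into functions of the same tuple, [v] followed by [al]. *)
pose e1 := reindex (map (index^~ (rcons v al)) (rcons u al)) e.
pose g1 := reindex (map (index^~ (rcons v al)) s) g.
have e1E w : e1 (map w (rcons v al)) = e (map w (rcons u al)) by exact: reindex_index.
have g1E w : g1 (map w (rcons v al)) = g (map w s) by exact: reindex_index.
have Ge1 : G e1 by exact: G_reindex.
have Gg1 : G g1 by exact: G_reindex.
have [g0 Gg0 [A' CA' A'g0]] := dec _ _ (G_op 2 Gg1 Ge1) vI.
pose e2 := op 0 e1 (op 1 g1 g0).
have e2P l : e2 l = tt <-> e1 l = tt /\ g1 l = g0 [::].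
  split; first by move=> /ite_tt[e1t /ite_tt].
  by move=> [e1t g1g0]; rewrite /e2 /= iteT//; split=> //; rewrite iteT.
exists (e2, v); split.
- split=> //=; first by apply: G_op => //; exact: G_op.
  exists (A `&` A'); first exact: CI.
  move=> w [/Ae/= mw /A'g0/= domw].
  have : most e1 (map w v).
    move=> sm; apply: mw; apply: small_sub sm => y /=.
    by rewrite -!(map_upd_rcons w y)// e1E.
  have := svalP (cid (dom_ex g1 e1 (map w v))) => /[apply] nsm sm; apply: nsm.
  apply: small_sub sm => y [e1t g1d] /=; apply/e2P; split=> //.
  by rewrite g1d -domw.
- by move=> w /e2P[]; rewrite e1E.
- by exists g0 => // w /e2P[_]; rewrite g1E.
Qed.

Let cond0 : cond (fun=> tt, [::]).
Proof.
case: IC => _ [[A CA] _ _] _ _ _.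
split=> //; exists A => // w _ /= sm; apply: smallT.
by apply: small_sub sm.
Qed.

Let cond_cyl0 A p : C A -> cond p -> A `&` cyl p !=set0.
Proof.
case: IC => _ [_ CI C0] inv _ _ CA [Gp pI [A' CA' A'p]].
have [w [Aw A'w]] := C0 _ (CI _ _ CA CA').
have [y ey] : [set y | p.1 (rcons (map w p.2) y) = tt] !=set0.
  apply/set0P/negP => /eqP e0; apply: (A'p _ A'w) => /=.
  (* The empty set is small, as a subset of any set of points near a given one. *)
  by rewrite e0; apply: small_sub (small_near k0).
exists (upd w y); split; last by rewrite /cyl/= map_upd_rcons.
apply: inv Aw => // i Ii; rewrite /upd; case: eqP => // ial.
by case: alI; rewrite -ial.
Qed.

(** Since [I] and [G] are countable, so are the requirements [(g, s)], and a decreasing sequence of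
    conditions meets them one by one. The sequence needs no lower bound: each member of the new
    family involves a single cylinder. *)
Lemma generic_extend : exists C', C `<=` C' /\ generic (I `|` [set al]) C'.
Proof.
have [e Ie] : exists e : nat -> W, I `|` [set al] `<=` range e.
  apply: countable_enum => //; rewrite -bigcup2E.
  by apply: bigcup_countable => // -[|[|i]] _ //=; exact: countable1.
have [gam Ggam] := countable_enum (fun=> tt) countable_G.
pose req (k : nat) : nat * seq nat := odflt (0, [::]) (unpickle k).
have step_ex (kp : nat * ((seq K -> L) * seq W)) : exists p', cond kp.2 ->
    [/\ cond p', cyl p' `<=` cyl kp.2 &
      let g := gam (req kp.1).1 in let s := map e (req kp.1).2 in
      G g -> (forall i, i \in s -> I i \/ i = al) ->
      exists2 g0, G g0 & cyl p' `<=` [set w | g (map w s) = g0 [::]]].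
  case: kp => k p /=; have [cp|] := pselect (cond p); last by exists p.
  set g := gam _; set s := map _ _.
  have [[Gg sI]|nreq] := pselect (G g /\ (forall i, i \in s -> I i \/ i = al)).
    by have [p' [? ? ?]] := cond_step cp Gg sI; exists p'.
  by exists p => _; split=> // Gg sI; case: nreq.
have [step stepP] := choice step_ex.
pose p_ := fix p_ k := if k is k'.+1 then step (k', p_ k') else (fun=> tt, [::]).
have p_cond k : cond (p_ k).
  by elim: k => [|k IH]; [exact: cond0|have [] := stepP (k, p_ k) IH].
have p_dec k m : (k <= m)%N -> cyl (p_ m) `<=` cyl (p_ k).
  elim: m => [|m IH]; first by rewrite leqn0 => /eqP->.
  rewrite leq_eqVlt => /orP[/eqP->//|]; rewrite ltnS => /IH.
  by apply: subset_trans; have [] := stepP (m, p_ m) (p_cond m).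
have p_req g s : G g -> (forall i, i \in s -> I i \/ i = al) ->
    exists k, exists2 g0, G g0 & cyl (p_ k) `<=` [set w | g (map w s) = g0 [::]].
  move=> Gg sI; have [a _ ga] := Ggam _ Gg.
  have [idx sE] : exists idx, s = map e idx.
    elim: s sI => [|i s IH] sI; first by exists [::].
    have [|idx ->] := IH; first by move=> j js; apply: sI; rewrite inE js orbT.
    have [n _ <-] := Ie i (sI i (mem_head _ _)).
    by exists (n :: idx).
  pose k := pickle (a, idx); exists k.+1.
  have [_ _] := stepP (k, p_ k) (p_cond k).
  by rewrite /req pickleK /= ga -sE; apply.
case: IC => Idown [[A0 CA0] CI C0] inv dec Cnear.
exists [set B | exists A k, C A /\ B = A `&` cyl (p_ k)]; split.
  move=> A CA; exists A, 0; split=> //.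
  by apply/seteqP; split=> // w [].
split.
- move=> i j [Ij ij|-> ial]; left; [exact: Idown ij|exact: Ial].
- split.
  + by exists (A0 `&` cyl (p_ 0)), A0, 0.
  + move=> _ _ [A [k [CA ->]]] [A' [k' [CA' ->]]].
    exists (A `&` A'), (maxn k k'); split; first exact: CI.
    apply/seteqP; split=> [w [[Aw kw] [A'w k'w]]|w [[Aw A'w] mw]].
      by split=> //; rewrite /maxn; case: ifP.
    by split; split=> //; apply: p_dec mw; rewrite (leq_maxl,leq_maxr).
  + by move=> _ [A [k [CA ->]]]; exact: cond_cyl0.
- move=> _ [A [k [CA ->]]] w w' ww' [Aw kw]; split.
    by apply: inv Aw => // i Ii; apply: ww'; left.
  rewrite /cyl /=; suff <- : map w (rcons (p_ k).2 al) = map w' (rcons (p_ k).2 al) by [].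
  apply/eq_in_map => i; rewrite mem_rcons inE => /orP[/eqP->|ip].
    by apply: ww'; right.
  by apply: ww'; left; have [_ + _] := p_cond k; apply.
- move=> g s Gg sI; have [k [g0 Gg0 kg]] := p_req g s Gg sI.
  exists g0 => //; exists (A0 `&` cyl (p_ k)); first by exists A0, k.
  by move=> w [_ /kg].
- move=> i j [Ij|->] ij.
    have [A CA Aij] := Cnear _ _ Ij ij.
    exists (A `&` cyl (p_ 0)); first by exists A, 0.
    by move=> w [/Aij].
  have Ii := Ial ij.
  have [|k [g0 Gg0 kg]] := p_req far [:: i; al] G_far.
    by move=> i'; rewrite !inE => /orP[/eqP->|/eqP->]; [left|right].
  exists (A0 `&` cyl (p_ k)); first by exists A0, k.
  move=> w [_ /kg /= fw] wnear.
  have [Gp pI [A CA Ap]] := p_cond k.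
  have [w0 [Aw0 _]] := cond_cyl0 CA (p_cond k).
  apply: (Ap _ Aw0); apply: small_sub (small_near (w0 i)) => y /= py.
  have /kg /= : cyl (p_ k) (upd w0 y) by rewrite /cyl /= map_upd_rcons.
  rewrite -fw /upd eqxx; case: eqP => [ial|_]; first by case: alI; rewrite -ial.
  rewrite {2}/far /= iteT// /far/= => nearff; apply: contrapT => nnear.
  by apply: ttff; rewrite -nearff iteF.
Qed.
End Extension.

Let generic_total : exists C, generic setT C.
Proof.
(* A pair [(I, C)] is coded as a subset of a sum type, so that inclusion compares both components at
   once. *)
pose P (A : set (W + set Om)) := generic [set i | A (inl i)] [set B | A (inr B)].
have [||A [_ PA Amax]] := @Zorn_above _ P [set x | x = inr setT].
- split=> //=.
  + split; first by exists setT.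
    * by move=> _ _ [->] [->]; rewrite setTI.
    * by move=> _ [->]; exists (fun=> k0).
  + by move=> _ [->].
  + move=> g [|i s] Gg sI; last by have := sI i (mem_head _ _).
    by exists g => //; exists setT.
- move=> F [X0 FX0] FP Ftot.
  have two p q := total_bigcup2 (p := p) (q := q) Ftot.
  split=> /=.
  + move=> i j [X FX Xj] ij; exists X => //.
    by have [Xdown _ _ _ _] := FP _ FX; exact: Xdown ij.
  + split.
    * by have [_ [[B XB] _ _] _ _ _] := FP _ FX0; exists B, X0.
    * move=> B B' BF B'F; have [X [FX XB XB']] := two _ _ BF B'F.
      by exists X => //; have [_ [_ XI _] _ _ _] := FP _ FX; exact: XI.
    * by move=> B [X FX XB]; have [_ [_ _ X0'] _ _ _] := FP _ FX; exact: X0'.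
  + move=> B [X FX XB] w w' ww'; have [_ _ inv _ _] := FP _ FX.
    by apply: inv => // i Xi; apply: ww'; exists X.
  + move=> g s Gg sF.
    have [X FX sX] : exists2 X, F X & forall i, i \in s -> X (inl i).
      elim: s sF => [|i s IH] sF; first by exists X0.
      have [|X FX sX] := IH; first by move=> j js; apply: sF; rewrite inE js orbT.
      have [Y FY Yi] := sF i (mem_head _ _).
      have [XY|YX] := Ftot _ _ FX FY.
        by exists Y => // j; rewrite inE => /orP[/eqP->//|/sX/XY].
      by exists X => // j; rewrite inE => /orP[/eqP->|/sX//]; exact: YX.
    have [_ _ _ dec _] := FP _ FX.
    by have [g0 Gg0 [B XB Bg]] := dec _ _ Gg sX; exists g0 => //; exists B => //; exists X.
  + move=> i j [X FX Xj] ij; have [_ _ _ _ Xnear] := FP _ FX.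
    by have [B XB Bn] := Xnear _ _ Xj ij; exists B => //; exists X.
exists [set B | A (inr B)]; suff <- : [set i | A (inl i)] = setT by [].
apply/seteqP; split=> // i0 _; apply: contrapT => nAi0.
(* A maximal segment missing an index consists of the predecessors of the least missing index [al];
   it is countable by the choice of the order, so [generic_extend] adds [al] to it. *)
have [wf _ tot cseg _] := W_omega1.
have [al nAal almin] := omega1_min W_omega1 (A := [set i | ~ A (inl i)]) (ex_intro _ i0 nAi0).
have [Adown _ _ _ _] := PA.
have Aal i : lt i al -> A (inl i).
  move=> ial; apply: contrapT => /almin[ali|ali].
    by apply: (omega1_irr W_omega1 (x := i)); rewrite -{2}ali.
  apply: (omega1_irr W_omega1 (x := al)).
  by have [_ trans _ _ _] := W_omega1; exact: trans ali ial.
have cA : countable [set i | A (inl i)].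
  apply: sub_countable (cseg al); apply: subset_card_le => i /= Ai.
  by case: (tot i al) => // [ia|/(Adown _ _ Ai)//]; case: nAal; rewrite -ia.
have [C' [CC' gC']] := generic_extend PA cA nAal Aal.
apply: nAal; apply: (Amax [set x | match x with
  | inl i => A (inl i) \/ i = al | inr B => C' B end]) => /=.
- by move=> [i|B] ?; [left|exact: CC'].
- exact: gC'.
- by right.
Qed.

Lemma generic_ultrafilter_closed : exists U : set_system Om, [/\ UltraFilter U,
  forall g s, G g -> exists2 g0, G g0 & U [set w | g (map w s) = g0 [::]] &
  forall i j, lt i j -> U [set w | ~ near (w i) (w j)]].
Proof.
have [C [_ [[A0 CA0] CI C0] _ dec Cnear]] := generic_total.
have CF : ProperFilter [set B | exists2 A, C A & A `<=` B].
  apply: Build_ProperFilter_ex => [B [A /C0[w Aw] AB]|].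
    by exists w; exact: AB.
  split=> [|B B' [A CA AB] [A' CA' AB']|B B' BB' [A CA AB]].
  - by exists A0.
  - by exists (A `&` A'); [exact: CI|exact: setISS].
  - by exists A => //; exact: subset_trans BB'.
have [U [UU CU]] := ultraFilterLemma CF.
exists U; split=> // [g s Gg|i j ij].
  by have [//|g0 Gg0 [A CA Ag]] := dec g s Gg; exists g0 => //; apply: CU; exists A.
by have [//|A CA Ag] := Cnear i j _ ij; apply: CU; exists A.
Qed.

End Closed.

Lemma generic_ultrafilter (G0 : set (seq K -> L)) : countable G0 ->
  exists (U : set_system Om) (L0 : set L), [/\ UltraFilter U, countable L0,
    forall g s, G0 g -> exists2 d, L0 d & U [set w | g (map w s) = d] &
    forall i j, lt i j -> U [set w | ~ near (w i) (w j)]].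
Proof.
move=> cG0; have [|G [cG G0G Gop]] := @countable_closure _ (G0 `|` [set far; fun=> tt]) op.
  rewrite -bigcup2E; apply: bigcup_countable => // -[|[|i]] _ //=.
  exact: finite_set_countable.
have [||U [UU Udec Unear]] := generic_ultrafilter_closed cG _ _ Gop.
- by apply: G0G; right; left.
- by apply: G0G; right; right.
exists U, [set g [::] | g in G]; split=> //.
  by apply: card_le_trans cG; exact: card_image_le.
move=> g s /(or_introl (B := _))/G0G Gg.
by have [g0 Gg0 Ug] := Udec g s Gg; exists (g0 [::]) => //; exists g0.
Qed.

(** A name is a tree over [W]. Renaming its leaves by their positions in the list of leaves turns a
    decision about it into one of countably many functions of finite tuples, to which
    [generic_ultrafilter] applies. *)
Theorem generic_names (Q : Type) (v : K -> Q) (Theta : set (Q -> Q -> Q))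
    (Delta : set (Q -> L)) : countable Theta -> countable Delta ->
  exists (U : set_system Om) (N : set (Om -> Q)) (L0 : set L),
  [/\ UltraFilter U /\ countable L0,
      forall i, N (fun w => v (w i)),
      forall th a b, Theta th -> N a -> N b -> N (fun w => th (a w) (b w)),
      forall de a, Delta de -> N a -> exists2 d, L0 d & U [set w | de (a w) = d] &
      (forall i j, lt i j -> U [set w | ~ near (w i) (w j)]) /\
      N #<= [set: W * nat]].
Proof.
move=> cTheta cDelta.
have [th Thth] := countable_enum (fun a _ => a) cTheta.
pose name (t : tm W) (w : Om) : Q := tm_eval th (fun i => v (w i)) t.
pose G0 := [set g | exists2 de, Delta de & exists t : tm nat,
  g = fun l => de (tm_eval th (fun n => v (nth k0 l n)) t)].
have [|U [L0 [UU cL0 Udec Unear]]] := @generic_ultrafilter G0.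
  have -> : G0 = \bigcup_(t in [set: tm nat])
      ((fun de l => de (tm_eval th (fun n => v (nth k0 l n)) t)) @` Delta).
    apply/seteqP; split=> [g [de Dde [t ->]]|_ [t _ [de Dde <-]]].
      by exists t => //; exists de.
    by exists de => //; exists t.
  apply: bigcup_countable => [|t _]; first exact: countable_tm.
  by apply: card_le_trans cDelta; exact: card_image_le.
exists U, (range name), L0; split=> //.
- by move=> i; exists (Leaf i).
- move=> t _ _ /Thth[k _ <-] [t1 _ <-] [t2 _ <-].
  by exists (Node k t1 t2).
- move=> de _ Dde [t _ <-]; pose s := tm_leaves t.
  have [|d L0d Ud] := Udec (fun l => de (tm_eval th (fun n => v (nth k0 l n))
    (tm_map (index^~ s) t))) s.
    by exists de => //; exists (tm_map (index^~ s) t).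
  exists d => //; apply: filterS Ud => w /= <-; rewrite tm_eval_map; congr de.
  have : {subset tm_leaves t <= s} by [].
  move: (s); rewrite /name; elim: t {s} => [i|k t1 IH1 t2 IH2] s ss /=.
    have is_ : i \in s by exact/ss/mem_head.
    by rewrite (nth_map i) ?index_mem// nth_index.
  congr (th k _ _); [apply: IH1|apply: IH2] => i it; apply: ss;
    by rewrite mem_cat it ?orbT.
- split=> //.
  (* The leaves of a tree are bounded by one of them, and the initial segment up to this bound is
     enumerated by [nat]. The tree is thus determined by its bound and by a tree over [nat]. *)
  have [wf trans tot cseg _] := W_omega1.
  have enum x : exists e : nat -> W, [set y | lt y x] `|` [set x] `<=` range e.
    apply: (countable_enum x); rewrite -bigcup2E.
    by apply: bigcup_countable => // -[|[|i]] _ //=; exact: countable1.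
  have [e eP] := choice enum.
  have le_e x y : y = x \/ lt y x -> exists n, e x n = y.
    by case=> yx; have [n _ <-] := eP x y ltac:(by [left|right]); exists n.
  have [ups upsP] : exists up : tm W -> W,
      forall t y, y \in tm_leaves t -> y = up t \/ lt y (up t).
    suff /choice[up upP] : forall t : tm W,
        exists x, forall y, y \in tm_leaves t -> y = x \/ lt y x.
      by exists up.
    elim=> [x|k t1 [x1 x1P] t2 [x2 x2P]].
      by exists x => y; rewrite inE => /eqP->; left.
    have lelt y x x' : y = x \/ lt y x -> lt x x' -> lt y x'.
      by move=> [->//|yx]; exact: trans.
    case: (tot x1 x2) => x12; [exists x2|exists x2|exists x1] => y;
      rewrite mem_cat => /orP[/x1P|/x2P] //.
    + by move=> /lelt /(_ x12); right.
    + by rewrite x12.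
    + by move=> /lelt /(_ x12); right.
  have pre t x : (forall y, y \in tm_leaves t -> y = x \/ lt y x) ->
      exists t' : tm nat, t = tm_map (e x) t'.
    elim: t => [y|k t1 IH1 t2 IH2] tx.
      by have [n <-] := le_e _ _ (tx y (mem_head _ _)); exists (Leaf n).
    have [|t1' ->] := IH1; first by move=> y yt; apply: tx; rewrite mem_cat yt.
    have [|t2' ->] := IH2; first by move=> y yt; apply: tx; rewrite mem_cat yt orbT.
    by exists (Node k t1' t2').
  apply: (@card_le_trans _ _ _ [set: tm W]); first exact: card_image_le.
  have /countable_injP[c cinj] := countable_tm.
  have pre' t : exists t' : tm nat, t = tm_map (e (ups t)) t' by apply: pre; exact: upsP.
  have [pr prP] := choice pre'.
  apply: (@card_le_of_inj _ _ _ _ (fun t => (ups t, c (pr t)))) => // t t' _ _ [upE].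
  move=> /cinj prE; rewrite (prP t) (prP t') upE prE ?inE//.
Qed.

End Generic.

Import Order.TTheory GRing.Theory Num.Theory.
Import numFieldNormedType.Exports.

Local Open Scope ring_scope.

(** * The open mapping theorem *)

Lemma expr2_small (R : realType) (c e : R) : 0 < e -> exists n, c / 2 ^+ n < e.
Proof.
move=> e0; exists (Num.bound (c / e)).
have [c0|c0] := ltP c 0.
  by apply: lt_le_trans (ltW e0); rewrite pmulr_llt0// invr_gt0 exprn_gt0.
rewrite ltr_pdivrMr ?exprn_gt0// mulrC -ltr_pdivrMr//.
apply: (lt_le_trans (archi_boundP _)); first by rewrite divr_ge0// ltW.
by rewrite -natrX ler_nat ltnW// ltn_expl.
Qed.

Lemma inv_nat_small (R : realType) (e : R) : 0 < e -> exists n : nat, n.+1%:R^-1 < e.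
Proof.
move=> e0; exists (Num.bound e^-1); rewrite invf_plt ?posrE//.
by apply: lt_trans (archi_boundP _) _; rewrite ?ltr_nat// invr_ge0 ltW.
Qed.

Lemma geometric_cvg (R : realType) (V : completeNormedModType R) (z : nat -> V)
    (c : R) : (forall k, `|z k.+1 - z k| <= c / 2 ^+ k) ->
  exists y, forall n, `|y - z n| <= 2 * c / 2 ^+ n.
Proof.
move=> zc.
have c0 : 0 <= c.
  by have := zc 0; rewrite expr0 divr1; apply: le_trans.
have E n : 2 * c / 2 ^+ n - c / 2 ^+ n = 2 * c / 2 ^+ n.+1 :> R.
  rewrite exprS invfM; have : (2 : R) * 2^-1 = 1 by rewrite divff.
  move: (2 ^+ n)^-1 => t; lra.
have tele n k : `|z (n + k)%N - z n| <= 2 * c / 2 ^+ n - 2 * c / 2 ^+ (n + k).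
  elim: k => [|k IH]; first by rewrite addn0 !subrr normr0.
  rewrite addnS -E; have := ler_normD (z (n + k).+1 - z (n + k)%N) (z (n + k)%N - z n).
  by rewrite subrKA; have := zc (n + k)%N; lra.
have tele' n m : (n <= m)%N -> `|z m - z n| <= 2 * c / 2 ^+ n.
  move=> /subnKC <-; apply: le_trans (tele _ _) _.
  by rewrite lerBlDr lerDl divr_ge0// mulr_ge0.
have cz : cvg (z @ \oo).
  apply: cauchy_cvg; apply: cauchy_exP => e e0.
  have [n ne] := expr2_small (2 * c) e0.
  exists (z n); exists n => // m /= nm.
  by rewrite -ball_normE /= distrC; apply: le_lt_trans ne; exact: tele'.
exists (lim (z @ \oo)) => n; apply/ler_addgt0Pr => e e0.
have /cvgrPdist_le/(_ e e0) [m _ mP] := cz.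
have := mP (maxn m n) (leq_maxl _ _); have := tele' n _ (leq_maxr m n).
have := ler_normD (lim (z @ \oo) - z (maxn m n)) (z (maxn m n) - z n).
rewrite subrKA /=; lra.
Qed.

(** Approximate solutions are corrected repeatedly, each correction halving the error; the factor 2
    in the bound is the sum of the geometric series. *)
Lemma almost_surjective (R : realType) (X : completeNormedModType R)
    (Y : normedModType R) (T : {linear X -> Y}) (B C : R) : 0 <= C ->
  (forall x, `|T x| <= B * `|x|) ->
  (forall y, exists2 x, `|x| <= C * `|y| & `|y - T x| <= `|y| / 2) ->
  forall y, exists2 x, `|x| <= 2 * C * `|y| & T x = y.
Proof.
move=> C0 TB app y.
have [s sP] := choice (fun y => let: ex_intro2 x p q := app y in
  ex_intro (fun x => `|x| <= C * `|y| /\ `|y - T x| <= `|y| / 2) x (conj p q)).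
pose z := fix z k := if k is k'.+1 then z k' + s (y - T (z k')) else 0.
have yz k : `|y - T (z k)| <= `|y| / 2 ^+ k.
  elim: k => [|k IH]; first by rewrite raddf0 subr0 expr0 divr1.
  rewrite /= raddfD opprD addrA; apply: le_trans (sP _).2 _.
  by rewrite exprSr invfM mulrA ler_pM2r.
have [k|x xP] := @geometric_cvg _ _ z (C * `|y|).
  rewrite /= addrAC subrr add0r; apply: le_trans (sP _).1 _.
  by rewrite -mulrA ler_wpM2l.
exists x; first by have := xP 0; rewrite subr0 expr0 divr1 mulrA.
apply/eqP; rewrite -subr_eq0 -normr_le0; apply/ler_addgt0Pr => e e0.
rewrite add0r; have [n ne] := expr2_small (`|B| * (2 * (C * `|y|)) + `|y|) e0.
apply: le_trans (ltW ne).
have -> : T x - y = T (x - z n) - (y - T (z n)).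
  by rewrite raddfB opprB addrA subrK.
apply: le_trans (ler_normB _ _) _; rewrite mulrDl lerD//.
apply: le_trans (TB _) _; apply: le_trans (_ : `|B| * `|x - z n| <= _).
  by rewrite ler_wpM2r// ler_norm.
by rewrite -[leRHS]mulrA ler_wpM2l.
Qed.

Lemma open_mapping (R : realType) (X Y : completeNormedModType R)
    (T : {linear X -> Y}) (B : R) : (forall x, `|T x| <= B * `|x|) ->
  (forall y, exists x, T x = y) ->
  exists2 C, 0 <= C & forall y, exists2 x, `|x| <= C * `|y| & T x = y.
Proof.
move=> TB Tsurj.
pose D (n : nat) := T @` [set x | `|x| <= n%:R].
have [n [O [[y0 Oy0] openO OD]]] : exists n, exists O : set Y,
    [/\ O !=set0, open O & O `<=` closure (D n)].
  apply: contrapT => /forallNP nD.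
  (* If no closure of a [D n] had interior points, their complements would be dense open sets, with
     a common point outside the range of [T]. *)
  have /Baire : forall n, open (~` closure (D n)) /\ dense (~` closure (D n)).
    move=> n; split; first exact/closed_openC/closed_closure.
    move=> O O0 openO; apply: contrapT => OD; apply: (nD n); exists O; split=> //.
    by move=> y Oy; apply: contrapT => Dy; apply: OD; exists y.
  case/(_ setT) => [||y [_ Dy]]; [by exists 0|exact: openT|].
  have [x xy] := Tsurj y.
  apply: (Dy (Num.bound `|x|)) => //; apply: subset_closure; exists x => //=.
  by rewrite ltW// archi_boundP.
have /nbhs_ballP[r /= r0 rO] : nbhs y0 O by exact: open_nbhs_nbhs.
have app u e : 0 < e -> `|u| < r -> exists2 x, `|x| <= 2 * n%:R & `|u - T x| <= 2 * e.
  move=> e0 ur.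
  (* A small vector [u] is a difference of two points of [O]; approximating both doubles the bound
     and the error. *)
  have near v : O v -> exists2 x, `|x| <= n%:R & `|v - T x| < e.
    move=> /OD/(_ _ (nbhsx_ballx v _ e0))[_ [[x xn <-]]].
    by rewrite -ball_normE; exists x.
  have [x xn ux] := near (y0 + u) ltac:(by apply: rO; rewrite -ball_normE /= opprD addNKr normrN).
  have [x' x'n yx'] := near y0 Oy0.
  exists (x - x'); first by apply: le_trans (ler_normB _ _) _; lra.
  have -> : u - T (x - x') = (y0 + u - T x) - (y0 - T x').
    by rewrite raddfB !opprB [RHS]addrC !addrA subrK [u + _]addrC.
  by apply: le_trans (ler_normB _ _) _; lra.
(* A vector [y] is rescaled to norm r / 2, within reach of [app]. Scaling back multiplies by 2 |y| /
   r, which turns the bound 2 n into C |y| and, for e = r / 8, the error r / 4 into |y| / 2. *)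
pose C := 4 * n%:R / r.
have C0 : 0 <= C by rewrite divr_ge0// ?mulr_ge0// ltW.
exists (2 * C); first by rewrite mulr_ge0.
apply: (almost_surjective C0 TB) => y.
have [->|y_neq0] := eqVneq y 0.
  by exists 0; rewrite ?normr0 ?mulr0// raddf0 subr0 normr0 mul0r.
have ny : 0 < `|y| by rewrite normr_gt0.
pose k := r / (2 * `|y|).
have k0 : 0 < k by rewrite divr_gt0// mulr_gt0.
have [||x xn ux] := app (k *: y) (r / 8).
- by rewrite divr_gt0.
- rewrite normrZ gtr0_norm// /k invfM mulrA divfK ?gt_eqF//.
  by rewrite ltr_pdivrMr// ltr_pMr// ltr1n.
exists (k^-1 *: x).
  rewrite normrZ normfV gtr0_norm// /C /k invf_div.
  apply: le_trans (_ : 2 * `|y| / r * (2 * n%:R) <= _).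
    by rewrite ler_wpM2l// divr_ge0// ?mulr_ge0// ltW.
  lra.
have -> : y - T (k^-1 *: x) = k^-1 *: (k *: y - T x).
  by rewrite linearZ scalerBr scalerA mulVf ?gt_eqF// scale1r.
rewrite normrZ normfV gtr0_norm// mulrC ler_pdivrMr//.
apply: le_trans ux _; rewrite /k invfM.
have : r * (`|y| * `|y|^-1) = r by rewrite mulfV ?mulr1// gt_eqF.
lra.
Qed.

(** * Separated reduced powers *)

Definition ulim (R : realType) (Om : Type) (U : set_system Om) (g : Om -> R) (l : R) :=
  forall e, 0 < e -> U [set w | `|g w - l| <= e].

Section Ulim.
Context (R : realType) (Om : Type) (U : set_system Om) {UU : UltraFilter U}.
Implicit Types (g : Om -> R) (l : R).

Lemma ulim_cst l : ulim U (fun=> l) l.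
Proof. by move=> e e0; apply: filterE => w /=; rewrite subrr normr0 ltW. Qed.

Lemma ulim_le g g' l l' : ulim U g l -> ulim U g' l' ->
  U [set w | g w <= g' w] -> l <= l'.
Proof.
move=> gl gl' gg'; apply/ler_addgt0Pr => e e0.
have e20 : 0 < e / 2 by rewrite divr_gt0.
have [w [[/= + +] +]] := filter_ex (filterI (filterI (gl _ e20) (gl' _ e20)) gg').
rewrite !ler_distl; lra.
Qed.

Lemma ulim_unique g l l' : ulim U g l -> ulim U g l' -> l = l'.
Proof.
move=> gl gl'; apply: le_anti; apply/andP; split.
  by apply: ulim_le gl gl' _; apply: filterE => w /=.
by apply: ulim_le gl' gl _; apply: filterE => w /=.
Qed.

Lemma ulim_eq g g' l : ulim U g l -> U [set w | g w = g' w] -> ulim U g' l.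
Proof. by move=> gl gg' e /gl; apply: filterS2 gg' => w /= ->. Qed.

Lemma ulim_gt g l c : ulim U g l -> c < l -> U [set w | c < g w].
Proof.
move=> gl cl; have d0 : 0 < (l - c) / 2 by rewrite divr_gt0// subr_gt0.
by apply: filterS (gl _ d0) => w /=; rewrite ler_distl; lra.
Qed.

Lemma ulim_lt g l c : ulim U g l -> l < c -> U [set w | g w < c].
Proof.
move=> gl cl; have d0 : 0 < (c - l) / 2 by rewrite divr_gt0// subr_gt0.
by apply: filterS (gl _ d0) => w /=; rewrite ler_distl; lra.
Qed.

(** The limit is the supremum of the reals that lie below [g] almost everywhere. *)
Lemma ulim_ex g a b : U [set w | a <= g w <= b] -> exists l, ulim U g l.
Proof.
move=> gab; pose S := [set r | U [set w | r <= g w]].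
have Sb : has_sup S.
  split; first by exists a; apply: filterS gab => w /andP[].
  exists b => r Sr; have [w [/= rg /andP[_]]] := filter_ex (filterI Sr gab).
  exact: le_trans.
exists (sup S) => e e0.
have [r Sr re] := sup_adherent e0 Sb.
have nS : ~ S (sup S + e).
  move=> /(sup_upper_bound Sb); rewrite gerDl => /le_lt_trans/(_ e0).
  by rewrite ltxx.
have [//|Ue] := in_ultra_setVsetC [set w | sup S + e <= g w] UU.
apply: filterS2 Sr Ue => w /= rg /negP; rewrite -ltNge => ge.
by rewrite ler_distl (ltW ge) andbT (le_trans (ltW re) rg).
Qed.

Lemma ulim_scale g l c : ulim U g l -> ulim U (fun w => c * g w) (c * l).
Proof.
move=> gl e e0; have c0 : 0 < `|c| + 1 by rewrite ltr_wpDl.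
have ec : 0 < e / (`|c| + 1) by rewrite divr_gt0.
apply: filterS (gl _ ec) => w /=; rewrite ler_pdivlMr// => h.
rewrite -mulrBr normrM; apply: le_trans h.
by rewrite mulrC ler_wpM2l// lerDl.
Qed.

End Ulim.

Arguments ulim_cst {R Om U} UU l.
Arguments ulim_le {R Om U} UU {g g' l l'} _ _ _.
Arguments ulim_unique {R Om U} UU {g l l'} _ _.
Arguments ulim_eq {R Om U} UU {g g' l} _ _.
Arguments ulim_gt {R Om U} UU {g l c} _ _.
Arguments ulim_lt {R Om U} UU {g l c} _ _.
Arguments ulim_ex {R Om U} UU {g a b} _.
Arguments ulim_scale {R Om U} UU {g l} c _.

(** Only rational multiples are required, because countably many operations must generate the names;
    real multiples are recovered in the closure [apx]. Boundedness almost everywhere makes the limit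
    of the norms exist. *)
Record name_space (R : realType) (V : normedModType R) (Om : Type)
    (U : set_system Om) := NameSpace {
  ns_ultra : UltraFilter U;
  names : set (Om -> V);
  names0 : names (fun=> 0);
  namesD : forall f g, names f -> names g -> names (fun w => f w + g w);
  namesZ : forall (q : rat) f, names f -> names (fun w => (ratr q : R) *: f w);
  names_bounded : forall f, names f -> exists M : R, U [set w | `|f w| <= M] }.

Section Approx.
Context (R : realType) (V : normedModType R) (Om : Type) (U : set_system Om).
Context (E : name_space V U).

#[local] Instance UU : UltraFilter U := ns_ultra E.

Definition apx (h : Om -> V) : Prop :=
  forall e : R, 0 < e -> exists2 f, names E f & U [set w | `|h w - f w| <= e].

Definition null (h : Om -> V) : Prop := ulim U (fun w => `|h w|) 0.

Lemma apx_name f : names E f -> apx f.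
Proof.
move=> Ef e e0; exists f => //; apply: filterE => w /=.
by rewrite subrr normr0 ltW.
Qed.

Lemma apx0 : apx (fun=> 0). Proof. exact: apx_name (names0 E). Qed.

Lemma apxD h k : apx h -> apx k -> apx (fun w => h w + k w).
Proof.
move=> hH kH e e0; have e20 : 0 < e / 2 by rewrite divr_gt0.
have [f Ef hf] := hH _ e20; have [g Eg kg] := kH _ e20.
exists (fun w => f w + g w); first exact: namesD.
apply: filterS2 hf kg => w /= hf kg; rewrite opprD addrACA.
by apply: le_trans (ler_normD _ _) _; lra.
Qed.

Lemma apx_bounded h : apx h -> exists2 M : R, 0 < M & U [set w | `|h w| <= M].
Proof.
move=> /(_ 1 ltr01)[f /names_bounded[M fM] hf]; exists (`|M| + 1).
  by rewrite ltr_wpDl.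
apply: filterS2 hf fM => w /= hf fM; have := ler_normD (h w - f w) (f w).
by rewrite subrK; have := ler_norm M; lra.
Qed.

Lemma apxZ (r : R) h : apx h -> apx (fun w => r *: h w).
Proof.
move=> hH e e0; have [M M0 hM] := apx_bounded hH.
have d0 : 0 < e / (2 * M) by rewrite divr_gt0// mulr_gt0.
have [q] : exists q : rat, ratr q \in `]r, r + e / (2 * M)[.
  by apply: rat_in_itvoo; rewrite ltrDl.
rewrite in_itv /= => /andP[rq qr].
have q0 : 0 < `|ratr q : R| + 1 by rewrite ltr_wpDl.
have c0 : 0 < e / 2 / (`|ratr q : R| + 1) by rewrite !divr_gt0.
have [f Ef hf] := hH _ c0; exists (fun w => (ratr q : R) *: f w); first exact: namesZ.
apply: filterS2 hM hf => w /= hM; rewrite ler_pdivlMr// => hf.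
have -> : r *: h w - ratr q *: f w = (r - ratr q) *: h w + ratr q *: (h w - f w).
  by rewrite scalerBl scalerBr addrA subrK.
apply: le_trans (ler_normD _ _) _; rewrite (normrZ (r - _)) (normrZ (ratr q)).
have : `|r - ratr q| * `|h w| <= e / 2.
  apply: le_trans (_ : e / (2 * M) * M <= _); last first.
    by rewrite invfM mulrA divfK ?gt_eqF.
  by apply: ler_pM => //; rewrite ler_distlC; apply/andP; split; lra.
have : `|ratr q : R| * `|h w - f w| <= e / 2.
  by apply: le_trans hf; rewrite mulrC ler_wpM2l// lerDl.
by move=> b a; rewrite [leRHS]splitr; exact: lerD.
Qed.

Lemma apxN h : apx h -> apx (fun w => - h w).
Proof.
by move=> /(apxZ (-1)) hH; under eq_fun do rewrite -scaleN1r.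
Qed.

Lemma apxB h k : apx h -> apx k -> apx (fun w => h w - k w).
Proof. by move=> hH /apxN kH; exact: apxD. Qed.

Lemma apx_lim h : apx h -> exists l, ulim U (fun w => `|h w|) l.
Proof.
move=> /apx_bounded[M _ hM]; apply: (ulim_ex UU (a := 0) (b := M)).
by apply: filterS hM => w /= ->; rewrite normr_ge0.
Qed.

Lemma apx_closed h : (forall e : R, 0 < e -> exists2 k, apx k &
  U [set w | `|h w - k w| <= e]) -> apx h.
Proof.
move=> hk e e0; have e20 : 0 < e / 2 by rewrite divr_gt0.
have [k kH hkw] := hk _ e20; have [f Ef kf] := kH _ e20.
exists f => //; apply: filterS2 hkw kf => w /= hkw kf.
have := ler_normD (h w - k w) (k w - f w); rewrite subrKA; lra.
Qed.

Lemma nullP h : null h <-> forall e : R, 0 < e -> U [set w | `|h w| <= e].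
Proof.
by split=> hU e /hU; apply: filterS => w /=; rewrite subr0 normr_id.
Qed.

Lemma null_eq h k : U [set w | h w = k w] -> null (fun w => h w - k w).
Proof.
move=> hk; apply/nullP => e e0; apply: filterS hk => w /= ->.
by rewrite subrr normr0 ltW.
Qed.

Lemma nullD h k : null h -> null k -> null (fun w => h w + k w).
Proof.
move=> /nullP hn /nullP kn; apply/nullP => e e0.
have e20 : 0 < e / 2 by rewrite divr_gt0.
apply: filterS2 (hn _ e20) (kn _ e20) => w /=.
have := ler_normD (h w) (k w); lra.
Qed.

Lemma nullZ (r : R) h : null h -> null (fun w => r *: h w).
Proof.
move=> hn; have {}hn := (ulim_scale UU) `|r| hn; rewrite mulr0 in hn.
by apply: (ulim_eq UU hn); apply: filterE => w /=; rewrite normrZ.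
Qed.

Lemma null_lim h k l : null (fun w => h w - k w) -> ulim U (fun w => `|h w|) l ->
  ulim U (fun w => `|k w|) l.
Proof.
move=> /nullP hk hl e e0; have e20 : 0 < e / 2 by rewrite divr_gt0.
apply: filterS2 (hk _ e20) (hl _ e20) => w /=; rewrite !ler_distl => d /andP[h1 h2].
have := ler_normD (h w - k w) (k w); have := ler_normB (h w) (h w - k w).
rewrite subrK subKr => *; apply/andP; split; lra.
Qed.

Definition same (h k : Om -> V) := apx k /\ null (fun w => h w - k w).

Definition canon (h : Om -> V) : Om -> V :=
  xget (fun=> 0 : V) [set k : {classic (Om -> V)} | same h k].

Lemma same_refl h : apx h -> same h h.
Proof. by move=> hH; split=> //; apply: null_eq; exact: filterE. Qed.

Lemma canonP h : apx h -> same h (canon h).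
Proof. by move=> hH; apply: (@xgetPex {classic (Om -> V)}); exists h; exact: same_refl. Qed.

Lemma null_sym h k : null (fun w => h w - k w) -> null (fun w => k w - h w).
Proof. by move=> /nullP hk; apply/nullP => e /hk; apply: filterS => w /=; rewrite distrC. Qed.

Lemma null_trans g h k : null (fun w => g w - h w) -> null (fun w => h w - k w) ->
  null (fun w => g w - k w).
Proof. by move=> /nullD gh /gh; under eq_fun do rewrite subrKA. Qed.

Lemma canon_eq h k : apx h -> apx k -> null (fun w => h w - k w) -> canon h = canon k.
Proof.
move=> hH kH hk; rewrite /canon; congr (xget _ _); apply/seteqP.
split=> g [gH ng]; split=> //; first exact: null_trans (null_sym hk) ng.
exact: null_trans hk ng.
Qed.

(** The quotient by null functions is realised by canonical representatives, as a subtype that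
    inherits the choice structure. *)
Definition redpow : Type :=
  {h : {classic (Om -> V)} | `[< apx h /\ canon h = h >]}.

HB.instance Definition _ := Choice.on redpow.

Definition rep (x : redpow) : Om -> V := val x.

Lemma rep_apx x : apx (rep x). Proof. by case/asboolP: (valP x). Qed.

Lemma canon_canon h : apx h -> apx (canon h) /\ canon (canon h) = canon h.
Proof.
move=> hH; have [cH hc] := canonP hH; split=> //.
by apply: canon_eq => //; exact: null_sym.
Qed.

Definition cls0 : redpow := exist _ (canon (fun=> 0)) (asboolT (canon_canon apx0)).

(* Opaque, so that unification does not unfold the operations of the quotient. *)
Lemma cls_ex : {cls : (Om -> V) -> redpow |
  [/\ forall h, apx h -> null (fun w => h w - rep (cls h) w),
      forall h k, apx h -> apx k -> null (fun w => h w - k w) -> cls h = cls k &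
      forall x, cls (rep x) = x]}.
Proof.
exists (fun h => insubd cls0 (canon h)); split=> [h hH|h k hH kH hk|x].
- rewrite /rep val_insubd asboolT; last exact: canon_canon.
  exact: (canonP hH).2.
- by rewrite (canon_eq hH kH hk).
- apply: val_inj; have /asboolP[xH cx] := valP x.
  by rewrite val_insubd asboolT//= cx.
Qed.

Definition cls : (Om -> V) -> redpow := sval cls_ex.

Lemma rep_cls h : apx h -> null (fun w => h w - rep (cls h) w).
Proof. by rewrite /cls; case: cls_ex => c /= [+ _ _]; exact. Qed.

Lemma clsE h k : apx h -> apx k -> null (fun w => h w - k w) -> cls h = cls k.
Proof. by rewrite /cls; case: cls_ex => c /= [_ + _]; exact. Qed.

Lemma cls_rep x : cls (rep x) = x.
Proof. by rewrite /cls; case: cls_ex => c /= []. Qed.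

Lemma cls_eq h k : apx h -> apx k -> U [set w | h w = k w] -> cls h = cls k.
Proof. by move=> hH kH hk; apply: clsE => //; exact: null_eq. Qed.

Definition rp_add (x y : redpow) := cls (fun w => rep x w + rep y w).
Definition rp_opp (x : redpow) := cls (fun w => - rep x w).
Definition rp_scale (r : R) (x : redpow) := cls (fun w => r *: rep x w).
Definition rp_zero : redpow := cls (fun=> 0).

Lemma rp_addE h k : apx h -> apx k -> rp_add (cls h) (cls k) = cls (fun w => h w + k w).
Proof.
move=> hH kH; apply: clsE; [by apply: apxD; exact: rep_apx|exact: apxD|].
have := nullD (null_sym (rep_cls hH)) (null_sym (rep_cls kH)).
by under eq_fun do rewrite addrACA -opprD.
Qed.

Lemma rp_oppE h : apx h -> rp_opp (cls h) = cls (fun w => - h w).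
Proof.
move=> hH; apply: clsE; [by apply: apxN; exact: rep_apx|exact: apxN|].
have := rep_cls hH; by under [X in null X -> _]eq_fun do rewrite addrC -[h _]opprK.
Qed.

Lemma rp_scaleE r h : apx h -> rp_scale r (cls h) = cls (fun w => r *: h w).
Proof.
move=> hH; apply: clsE; [by apply: apxZ; exact: rep_apx|exact: apxZ|].
have := nullZ r (null_sym (rep_cls hH)).
by under [X in null X -> _]eq_fun do rewrite scalerBr.
Qed.

Lemma rpP (P : redpow -> Prop) : (forall h, apx h -> P (cls h)) -> forall x, P x.
Proof. by move=> Pc x; rewrite -(cls_rep x); apply: Pc; exact: rep_apx. Qed.

Let apxE := (rp_addE, rp_oppE, rp_scaleE).

Lemma rp_addA : associative rp_add.
Proof.
elim/rpP => h hH; elim/rpP => k kH; elim/rpP => g gH.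
by rewrite !rp_addE//; do ?[exact: apxD]; congr cls; apply/funext => w; rewrite addrA.
Qed.

Lemma rp_addC : commutative rp_add.
Proof.
elim/rpP => h hH; elim/rpP => k kH.
by rewrite !rp_addE//; congr cls; apply/funext => w; rewrite addrC.
Qed.

Lemma rp_add0 : left_id rp_zero rp_add.
Proof.
elim/rpP => h hH; rewrite rp_addE//; last exact: apx0.
by congr cls; apply/funext => w; rewrite add0r.
Qed.

Lemma rp_addN : left_inverse rp_zero rp_opp rp_add.
Proof.
elim/rpP => h hH; rewrite rp_oppE// rp_addE//; last exact: apxN.
by congr cls; apply/funext => w; rewrite addNr.
Qed.

HB.instance Definition _ := GRing.isZmodule.Build redpow rp_addA rp_addC rp_add0 rp_addN.

Lemma rp_scaleA a b x : rp_scale a (rp_scale b x) = rp_scale (a * b) x.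
Proof.
elim/rpP: x => h hH; rewrite !rp_scaleE//; last exact: apxZ.
by congr cls; apply/funext => w; rewrite scalerA.
Qed.

Lemma rp_scale1 : left_id 1 rp_scale.
Proof.
elim/rpP => h hH; rewrite !rp_scaleE//.
by congr cls; apply/funext => w; rewrite scale1r.
Qed.

Lemma rp_scaleDr : right_distributive rp_scale +%R.
Proof.
move=> r; elim/rpP => h hH; elim/rpP => k kH.
rewrite [in LHS]/GRing.add/= [RHS]/GRing.add/= !apxE//; do ?[exact: apxD|exact: apxZ].
by congr cls; apply/funext => w; rewrite scalerDr.
Qed.

Lemma rp_scaleDl x : {morph rp_scale^~ x : a b / a + b}.
Proof.
move=> a b; elim/rpP: x => h hH.
rewrite [RHS]/GRing.add/= !apxE//; do ?[exact: apxZ].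
by congr cls; apply/funext => w; rewrite scalerDl.
Qed.

HB.instance Definition _ := GRing.Zmodule_isLmodule.Build R redpow
  rp_scaleA rp_scale1 rp_scaleDr rp_scaleDl.

Definition rp_norm (x : redpow) : R := sval (cid (apx_lim (rep_apx x))).

Lemma rp_normP h : apx h -> ulim U (fun w => `|h w|) (rp_norm (cls h)).
Proof.
move=> hH; apply: null_lim (null_sym (rep_cls hH)) _.
exact: (svalP (cid (apx_lim (rep_apx (cls h))))).
Qed.

Lemma clsD h k : apx h -> apx k -> cls h + cls k = cls (fun w => h w + k w).
Proof. exact: rp_addE. Qed.

Lemma clsN h : apx h -> - cls h = cls (fun w => - h w).
Proof. exact: rp_oppE. Qed.

Lemma clsB h k : apx h -> apx k -> cls h - cls k = cls (fun w => h w - k w).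
Proof. by move=> hH kH; rewrite clsN// clsD//; exact: apxN. Qed.

Lemma clsZ r h : apx h -> r *: cls h = cls (fun w => r *: h w).
Proof. exact: rp_scaleE. Qed.

Lemma cls00 : cls (fun=> 0) = 0. Proof. by []. Qed.

Lemma rp_normD x y : rp_norm (x + y) <= rp_norm x + rp_norm y.
Proof.
elim/rpP: x => h hH; elim/rpP: y => k kH; rewrite clsD//.
have hl := rp_normP hH; have kl := rp_normP kH; have hkl := rp_normP (apxD hH kH).
apply/ler_addgt0Pr => e e0; have e30 : 0 < e / 3 by rewrite divr_gt0.
have [w [[/= + +] +]] := filter_ex (filterI (filterI (hl _ e30) (kl _ e30)) (hkl _ e30)).
have := ler_normD (h w) (k w); rewrite !ler_distl; lra.
Qed.

Lemma rp_normZ r x : rp_norm (r *: x) = `|r| * rp_norm x.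
Proof.
elim/rpP: x => h hH; rewrite clsZ//.
apply: (ulim_unique UU) (rp_normP (apxZ r hH)) _.
by apply: (ulim_eq UU (ulim_scale UU `|r| (rp_normP hH))); apply: filterE => w /=; rewrite normrZ.
Qed.

Lemma rp_norm0 x : rp_norm x = 0 -> x = 0.
Proof.
elim/rpP: x => h hH h0; rewrite -cls00; apply: clsE => //; first exact: apx0.
have := rp_normP hH; rewrite h0 => hl.
by apply: (ulim_eq UU hl); apply: filterE => w /=; rewrite subr0.
Qed.

HB.instance Definition _ := Lmodule_isNormed.Build R redpow rp_normD rp_normZ rp_norm0.

Lemma norm_cls h : apx h -> ulim U (fun w => `|h w|) `|cls h|.
Proof. exact: rp_normP. Qed.

End Approx.

(** * Completeness of the reduced power *)

Section Complete.
Context (R : realType) (V : completeNormedModType R) (Om : Type) (U : set_system Om).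
Context (E : name_space V U).

#[local] Instance UUc : UltraFilter U := ns_ultra E.

Lemma redpow_seq_complete (x : nat -> redpow E) (c : R) :
  0 < c -> (forall n, `|x n.+1 - x n| < c / 2 ^+ n) ->
  exists y, forall n, `|y - x n| <= 2 * c / 2 ^+ n.
Proof.
move=> c0 xc; pose h n := rep (x n).
have hH n : apx E (h n) by exact: rep_apx.
pose good n := [set w | `|h n.+1 w - h n w| <= c / 2 ^+ n].
have Ugood n : U (good n).
  have := norm_cls (apxB (hH n.+1) (hH n)); rewrite -clsB// !cls_rep.
  by move=> /(ulim_lt UUc)/(_ (xc n)); apply: filterS => w /= /ltW.
have ex_y w : exists y, forall n, (forall i, (i < n)%N -> good i w) ->
    `|y - h n w| <= 2 * c / 2 ^+ n.
  (* Each [good n] belongs to [U], but their intersection need not. The sequence at [w] is frozen at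
     the first failure, hence converges for every [w], and it agrees with [h] up to [n] on a set in
     [U]. *)
  pose z := fix z k := if k is k'.+1 then
    (if pselect (forall i, (i < k'.+1)%N -> good i w) then h k'.+1 w else z k')
    else h 0 w.
  have zh k : (forall i, (i < k)%N -> good i w) -> z k = h k w.
    by case: k => //= k gk; case: pselect.
  have [k|y yP] := @geometric_cvg _ _ z c.
    rewrite /=; case: pselect => gk /=; last first.
      by rewrite subrr normr0 divr_ge0// ltW.
    by rewrite zh; [exact: gk|move=> i ik; apply: gk; exact: ltnW].
  by exists y => n /zh <-.
have [y yP] := choice ex_y.
have Uy n : U [set w | `|y w - h n w| <= 2 * c / 2 ^+ n].
  have : U [set w | forall i, (i < n)%N -> good i w].
    elim: n => [|n IH]; first exact: filterE.
    apply: filterS2 IH (Ugood n) => w /= gn nw i; rewrite ltnS leq_eqVlt.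
    by move=> /orP[/eqP->//|]; exact: gn.
  by apply: filterS => w /= /yP.
have yH : apx E y.
  apply: apx_closed => e e0; have [n ne] := expr2_small (2 * c) e0.
  by exists (h n) => //; apply: filterS (Uy n) => w /= /le_trans -> //; exact: ltW.
exists (cls E y) => n; rewrite -(cls_rep (x n)) clsB; [|by []|exact: rep_apx].
apply: (ulim_le UUc) (norm_cls (apxB yH (hH n))) (ulim_cst UUc _) _.
exact: Uy.
Qed.

Lemma redpow_complete (F : set_system (redpow E)) : ProperFilter F ->
  cauchy F -> cvg F.
Proof.
move=> FF /cauchyP Fc.
have e0 n : 0 < (1 : R) / 2 ^+ n by rewrite divr_gt0// exprn_gt0.
have [x xP] := choice (fun n => Fc _ (e0 n)).
(* Consecutive centres are less than 1 / 2^n + 1 / 2^(n+1) apart, whence the constant 2. *)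
have [//|n|y yP] := @redpow_seq_complete x 2.
  have [z []] := filter_ex (filterI (xP n) (xP n.+1)).
  rewrite -!ball_normE /= => xz xz'.
  apply: le_lt_trans (ler_distD z _ _) _; rewrite [`|z - _|]distrC.
  have -> : 2 / 2 ^+ n = 1 / 2 ^+ n + 1 / 2 ^+ n :> R by rewrite -mulrDl.
  rewrite addrC; apply: ltrD => //.
  apply: lt_le_trans xz' _.
  by rewrite ler_pM2l// lef_pV2 ?posrE ?exprn_gt0// exprS ler_peMl ?ler1n// exprn_ge0.
apply/cvg_ex; exists y; apply/cvgrPdist_le => e ep.
have [n ne] := expr2_small 5 ep.
apply: filterS (xP n) => z /=; rewrite -ball_normE /= => xz.
apply: le_trans (ler_distD (x n) _ _) _.
apply: le_trans (ltW ne); have -> : 5 / 2 ^+ n = 2 * 2 / 2 ^+ n + 1 / 2 ^+ n :> R.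
  lra.
by rewrite lerD// ltW.
Qed.

HB.instance Definition _ := Uniform_isComplete.Build (redpow E) redpow_complete.

End Complete.

(** * Transfer of formulas *)

Lemma eval01 (R : realType) (S : signature R) (M : structure S) G
  (phi : formula S G) (a : env (carrier M) G) : 0 <= Defs.eval phi a <= 1.
Proof.
elim: phi a => {G} [G s t1 t2|G p ts|G q q01|G f IHf g IHg|G f IH|G s f IH] a /=.
- by rewrite mdist_ge0 mdist_le1.
- exact: pint01.
- by rewrite ler0q -(rmorph1 (ratr : rat -> R)) ler_rat.
- have /andP[? ?] := IHf a; have /andP[? ?] := IHg a.
  rewrite ge_min lexx orbT andbT le_min ler01 andbT; lra.
- apply/andP; split.
    have ub : has_ubound (range (fun n => Defs.eval (f n) a)).
      by exists 1 => _ [n _ <-]; have /andP[] := IH n a.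
    apply: le_trans (_ : Defs.eval (f 0) a <= _); first by have /andP[] := IH 0 a.
    by apply: ub_le_sup => //; exists 0.
  by apply: ge_sup; [exists (Defs.eval (f 0) a), 0|move=> _ [n _ <-]; have /andP[] := IH n a].
- set A := (X in sup X); have [->|/set0P A0] := eqVneq A set0; first by rewrite sup0 lexx ler01.
  have ub y : A y -> y <= 1.
    by move=> [x _ <-]; have /andP[] := IH (env_cons x a).
  apply/andP; split; last exact: ge_sup.
  have [y [x xM xy]] := A0; have /andP[y0 _] := IH (env_cons x a).
  apply: le_trans y0 _; apply: ub_le_sup; first by exists 1.
  by exists x.
Qed.

Lemma var_case (I : Type) (G : seq I) (t : I) (P : forall s, var (t :: G) s -> Prop) :
  P t VZ -> (forall s (v : var G s), P s (VS v)) -> forall s v, P s v.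
Proof.
move=> P0 PS s v; move: P P0 PS.
refine (match v as v0 in var G' s' return
  match G' return var G' s' -> Prop with
  | [::] => fun=> True
  | t' :: G'' => fun v1 => forall P : (forall s, var (t' :: G'') s -> Prop),
      P t' VZ -> (forall s (v : var G'' s), P s (VS v)) -> P s' v1
  end v0 with VZ _ _ => _ | VS _ _ _ w => _ end).
- by move=> P P0 PS.
- by move=> P P0 PS.
Qed.

(** Rational thresholds keep the Skolem functions and the decisions countable in number. *)
Lemma rat_le (R : realType) (l l' : R) : (forall r : rat, ratr r < l -> ratr r <= l') -> l <= l'.
Proof.
move=> H; rewrite leNgt; apply/negP => ll'.
have [q /itvP qll'] := rat_in_itvoo ll'.
by have := H q; rewrite qll' => /(_ isT); rewrite leNgt qll'.
Qed.

Section Truncation.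
Context (R : realType).

Definition trunc (V : normedModType R) (n : nat) (x : V) : sball V n :=
  insubd (exist _ 0 (zero_subproof V n) : sball V n) x.

Lemma truncE (V : normedModType R) n (x : V) : `|x| <= n.+1%:R -> val (trunc n x) = x.
Proof. by move=> xn; rewrite val_insubd xn. Qed.

Lemma trunc_val (V : normedModType R) n (x : sball V n) : trunc n (val x) = x.
Proof. by apply: val_inj; rewrite truncE//; exact: (valP x). Qed.

Definition bval (X Y : normedModType R) (s : op_sort) (x : op_carrier X Y s) :
  op_space X Y s.1 := val (x : sball (op_space X Y s.1) s.2).

Lemma bval_le (X Y : normedModType R) s (x : op_carrier X Y s) : `|bval x| <= s.2.+1%:R.
Proof. exact: (valP (x : sball _ _)). Qed.

Lemma bval_inj (X Y : normedModType R) s : injective (@bval X Y s).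
Proof. by move=> x y; exact: val_inj. Qed.

Lemma mdist_bval (X Y : normedModType R) s (x y : op_carrier X Y s) :
  mdist x y = `|bval x - bval y| / (2 * s.2.+1%:R).
Proof. by []. Qed.

End Truncation.

Section Los.
Context (R : realType) (tau : nat -> nat) (mu : nat -> modulus R).
Context (X Y : normedModType R) (T : {linear X -> Y}) (TS : op_respects tau mu T).
Context (X' Y' : normedModType R) (T' : {linear X' -> Y'}) (TS' : op_respects tau mu T').
Context (Om : Type) (U : set_system Om) (UU : UltraFilter U).
Variable nm : forall b, set (Om -> op_space X Y b).
Variable pi : forall b, (Om -> op_space X Y b) -> op_space X' Y' b.
Arguments pi {b} _.
Hypothesis nm0 : forall b, nm (b := b) (fun=> 0).
Hypothesis pi0 : forall b, pi (b := b) (fun=> 0) = 0.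
Hypothesis nmD : forall b (f g : Om -> op_space X Y b), nm f -> nm g ->
  nm (fun w => f w + g w).
Hypothesis piD : forall b (f g : Om -> op_space X Y b), nm f -> nm g ->
  pi (fun w => f w + g w) = pi f + pi g.
Hypothesis nmZ : forall b (q : rat) (f : Om -> op_space X Y b), nm f ->
  nm (fun w => (ratr q : R) *: f w).
Hypothesis piZ : forall b (q : rat) (f : Om -> op_space X Y b), nm f ->
  pi (fun w => (ratr q : R) *: f w) = (ratr q : R) *: pi f.
Hypothesis nmT : forall f : Om -> X, nm (b := Dom) f -> nm (b := Cod) (fun w => T (f w)).
Hypothesis piT : forall f : Om -> X, nm (b := Dom) f ->
  pi (b := Cod) (fun w => T (f w)) = T' (pi (b := Dom) f).
Hypothesis nm_trunc : forall b n (f : Om -> op_space X Y b), nm f ->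
  nm (fun w => val (trunc n (f w))).
Hypothesis pi_norm : forall b (f : Om -> op_space X Y b), nm f ->
  ulim U (fun w => `|f w|) `|pi f|.
Hypothesis pi_eq : forall b (f g : Om -> op_space X Y b), nm f -> nm g ->
  U [set w | f w = g w] -> pi f = pi g.
Hypothesis pi_dense : forall b (x : op_space X' Y' b) (e : R), 0 < e ->
  exists2 f, nm f & `|x - pi f| < e.

Let S := op_signature tau mu.
Let M : structure S := op_structure TS.
Let M' : structure S := op_structure TS'.

Definition nm_env G (a : Om -> env (carrier M) G) : Prop :=
  forall (s : op_sort) (v : var G s), nm (fun w => bval (a w s v : op_carrier X Y s)).

Definition represents (s : op_sort) (x : op_carrier X' Y' s) (f : Om -> op_carrier X Y s) : Prop :=
  nm (fun w => bval (f w)) /\ bval x = pi (fun w => bval (f w)).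

Definition env_represents G (a' : env (carrier M') G) (a : Om -> env (carrier M) G) : Prop :=
  forall (s : op_sort) (v : var G s), represents (a' s v : op_carrier X' Y' s) (fun w => a w s v).

Lemma represents_dist s (x y : op_carrier X' Y' s) f g : represents x f -> represents y g ->
  ulim U (fun w => mdist (f w) (g w)) (mdist x y).
Proof.
move=> [nf xf] [ng yg].
have nN : nm (fun w => (ratr (-1) : R) *: bval (g w)) by exact: nmZ.
have h := ulim_scale UU (2 * s.2.+1%:R)^-1 (pi_norm (nmD nf nN)).
have -> : mdist x y =
    (2 * s.2.+1%:R)^-1 * `|pi (fun w => bval (f w) + (ratr (-1) : R) *: bval (g w))|.
  by rewrite mdist_bval xf yg piD// piZ// rmorphN1 scaleN1r mulrC.
apply: (ulim_eq UU h); apply: filterE => w /=.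
by rewrite mdist_bval rmorphN1 scaleN1r mulrC.
Qed.

Lemma represents_ex s (f : Om -> op_carrier X Y s) : nm (fun w => bval (f w)) ->
  exists x, represents x f.
Proof.
move=> nf; have h : `|pi (fun w => bval (f w))| <= s.2.+1%:R.
  apply: (ulim_le UU (pi_norm nf) (ulim_cst UU _)).
  by apply: filterE => w /=; exact: bval_le.
by exists (trunc s.2 (pi (fun w => bval (f w)))); split=> //; exact: truncE.
Qed.

(** A name close to a point of the sphere may leave the ball. The point is first multiplied by
    [1 - t], so that an approximation within [t * n] has norm below [n] in the limit and agrees with
    its truncation almost everywhere. *)
Lemma represents_dense s (x : op_carrier X' Y' s) (d : R) : 0 < d ->
  exists f y, represents y f /\ mdist x y < d.
Proof.
move=> d0; pose n := s.2.+1%:R : R.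
have n0 : 0 < n by rewrite ltr0n.
pose t := Num.min (1 / 2) (d / 2).
have t0 : 0 < t by rewrite lt_min !divr_gt0.
have t1 : t <= 1 / 2 by rewrite ge_min lexx.
have td : t <= d / 2 by rewrite ge_min lexx orbT.
pose x1 := (1 - t) *: bval x.
have x1n : `|x1| <= (1 - t) * n.
  rewrite normrZ ger0_norm; last by lra.
  by rewrite ler_wpM2l ?bval_le//; lra.
have [f nf xf] := pi_dense x1 (mulr_gt0 t0 n0).
have pfn : `|pi f| < n.
  have := ler_normB x1 (x1 - pi f); rewrite subKr; nra.
pose g w : op_carrier X Y s := trunc s.2 (f w).
have gE : pi (fun w => bval (g w)) = pi f.
  apply: pi_eq => //; first exact: nm_trunc.
  apply: filterS (ulim_lt UU (pi_norm nf) pfn) => w /= fw.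
  by apply: truncE; exact: ltW.
have ng : nm (fun w => bval (g w)) by exact: nm_trunc.
have [y [_ yg]] := represents_ex ng; exists g, y; split=> //.
rewrite mdist_bval yg gE ltr_pdivrMr ?mulr_gt0//.
have -> : bval x - pi f = t *: bval x + (x1 - pi f).
  by rewrite addrA /x1 -scalerDl addrCA subrr addr0 scale1r.
have := ler_normD (t *: bval x) (x1 - pi f); rewrite normrZ gtr0_norm//.
have := bval_le x; rewrite -/n => xn; nra.
Qed.

Lemma represents_term G (a' : env (carrier M') G) (a : Om -> env (carrier M) G) :
  env_represents a' a -> forall s (t : term G s),
  represents (teval a' t : op_carrier X' Y' s) (fun w => teval (a w) t).
Proof.
move=> ra s t; elim: t => {s} [s v|c|f ts IH].
- exact: ra.
- by split=> /=; [exact: nm0|rewrite pi0].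
- case: f ts IH => [b m n mn|b m n|b q m n qmn|n] ts IH.
  + have [n1 e1] := IH (b, m) VZ; split; first exact: n1.
    exact: e1.
  + have [n1 e1] := IH (b, m) VZ; have [n2 e2] := IH (b, n) (VS VZ).
    split; first exact: (nmD n1 n2).
    by apply: etrans (esym (piD n1 n2)); rewrite -e1 -e2.
  + have [n1 e1] := IH (b, m) VZ; split; first exact: (nmZ q n1).
    by apply: etrans (esym (piZ q n1)); rewrite -e1.
  + have [n1 e1] := IH (Dom, n) VZ; split; first exact: (nmT n1).
    by apply: etrans (esym (piT n1)); rewrite -e1.
Qed.

Local Notation ec := (env_cons (M := carrier M)).
Local Notation ec' := (env_cons (M := carrier M')).

Context (L : formula_set S) (Lfrag : fragment L) (Lcont : continuous_formula_set L).

Hypothesis skolem : forall G s (phi : formula S (s :: G)), L phi ->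
  forall (a : Om -> env (carrier M) G), nm_env a -> forall r : rat,
  exists f : Om -> op_carrier X Y s, nm (fun w => bval (f w)) /\
    forall w, (exists x : op_carrier X Y s, ratr r < Defs.eval phi (ec x (a w))) ->
      ratr r < Defs.eval phi (ec (f w) (a w)).

Hypothesis omit : forall G (phi : nat -> formula S G), L (SupN phi) ->
  forall (a : Om -> env (carrier M) G), nm_env a -> forall r : rat,
  U [set w | exists n, ratr r < Defs.eval (phi n) (a w)] ->
  exists n, U [set w | ratr r < Defs.eval (phi n) (a w)].

(** The analogue of the theorem of Los, by induction on the formula. For countable suprema [omit]
    supplies one index valid almost everywhere; for suprema over a sort [skolem] supplies a named
    near-maximiser. *)
Theorem los G (phi : formula S G) : L phi ->
  forall (a' : env (carrier M') G) (a : Om -> env (carrier M) G), env_represents a' a ->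
  ulim U (fun w => Defs.eval phi (a w)) (Defs.eval phi a').
Proof.
elim: phi => {G} [G s t1 t2|G p ts|G q q01|G f IHf g IHg|G f IH|G s f IH] Lphi a' a ra.
- exact: represents_dist (represents_term ra t1) (represents_term ra t2).
- have [nf e1] := represents_term ra (ts p VZ).
  have h := ulim_scale UU (p.2.+1%:R)^-1 (pi_norm nf).
  have -> : Defs.eval (Pred ts) a' =
      (p.2.+1%:R)^-1 * `|bval (teval a' (ts p VZ) : op_carrier X' Y' p)|.
    by rewrite mulrC.
  rewrite e1; apply: (ulim_eq UU h); apply: filterE => w /=.
  by rewrite mulrC.
- exact: ulim_cst.
- have [Lf Lg] := fragment_sub_imp Lfrag Lphi.
  move=> e e0; have e20 : 0 < e / 2 by rewrite divr_gt0.
  apply: filterS2 (IHf Lf _ _ ra _ e20) (IHg Lg _ _ ra _ e20) => w /=.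
  rewrite !ler_distl !minElt; do 2![case: ltP => ?]; lra.
- have Lf n := fragment_sub_supn Lfrag Lphi n.
  have [l gl] : exists l, ulim U (fun w => Defs.eval (SupN f) (a w)) l.
    by apply: (ulim_ex UU (a := 0) (b := 1)); apply: filterE => w; exact: eval01.
  suff -> : Defs.eval (SupN f) a' = l by [].
  have nb (N : structure S) (b : env (carrier N) G) : has_ubound (range (fun n => Defs.eval (f n) b)).
    by exists 1 => _ [n _ <-]; have /andP[] := eval01 (f n) b.
  apply: le_anti; apply/andP; split.
    apply: ge_sup; first by exists (Defs.eval (f 0) a'), 0.
    move=> _ [n _ <-]; apply: (ulim_le UU (IH n (Lf n) _ _ ra) gl).
    by apply: filterE => w /=; apply: ub_le_sup; [exact: nb|exists n].
  apply: rat_le => r rl.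
  have [|n Un] := omit Lphi (a := a) (fun s v => (ra s v).1) (r := r).
    apply: filterS (ulim_gt UU gl rl) => w /= rw; apply: contrapT => /forallNP nr.
    suff : Defs.eval (SupN f) (a w) <= ratr r by rewrite leNgt rw.
    apply: ge_sup; first by exists (Defs.eval (f 0) (a w)), 0.
    by move=> _ [n _ <-]; rewrite leNgt; apply/negP; exact: nr.
  apply: (@le_trans _ _ (Defs.eval (f n) a')); last by apply: ub_le_sup; [exact: nb|exists n].
  apply: (ulim_le UU (ulim_cst UU _) (IH n (Lf n) _ _ ra)).
  by apply: filterS Un => w /ltW.
- have Lf := fragment_sub_sup Lfrag Lphi.
  have [l gl] : exists l, ulim U (fun w => Defs.eval (Sup f) (a w)) l.
    by apply: (ulim_ex UU (a := 0) (b := 1)); apply: filterE => w; exact: eval01.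
  suff -> : Defs.eval (Sup f) a' = l by [].
  have nb (N : structure S) (b : env (carrier N) G) :
      has_ubound (range (fun x : N s => Defs.eval f (env_cons (M := carrier N) x b))).
    by exists 1 => _ [x _ <-]; have /andP[] := eval01 f (env_cons (M := carrier N) x b).
  have repc (x : op_carrier X' Y' s) (g : Om -> op_carrier X Y s) :
      represents x g -> env_represents (ec' x a') (fun w => ec (g w) (a w)).
    by move=> xg t; elim/var_case => [|t' v'] //; exact: ra.
  apply: le_anti; apply/andP; split.
    apply: ge_sup.
      by exists (Defs.eval f (ec' (cint M' s) a')), (cint M' s).
    (* An arbitrary [x] need not have a name; it is replaced by a nearby represented element, at a
       cost bounded by continuity of the subformula. *)
    move=> _ [x _ <-]; apply/ler_addgt0Pr => e e0.
    have [d d0 dP] := Lcont Lf (ec' x a') e0.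
    have [g [y [yg xy]]] := represents_dense x d0.
    have yl : Defs.eval f (ec' y a') <= l.
      have h := IH Lf _ _ (repc _ _ yg).
      apply: (ulim_le UU h gl).
      by apply: filterE => w /=; apply: ub_le_sup; [exact: (nb M (a w))|exists (g w)].
    have : env_close d (ec' x a') (ec' y a').
      by move=> t; elim/var_case => [|t' v'] //=; rewrite mdistxx.
    by move=> /dP; rewrite ltr_distl => /andP[_ /ltW xl]; apply: le_trans xl _; rewrite lerD2r.
  apply: rat_le => r rl.
  have [h0 [nh0 h0P]] := skolem Lf (a := a) (fun s v => (ra s v).1) r.
  have [y yh] := represents_ex nh0.
  apply: (@le_trans _ _ (Defs.eval f (ec' y a'))); last by apply: ub_le_sup; [exact: nb|exists y].
  have h := IH Lf _ _ (repc _ _ yh).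
  apply: (ulim_le UU (ulim_cst UU _) h).
  apply: filterS (ulim_gt UU gl rl) => w /= rw; apply/ltW/h0P.
  apply: contrapT => /forallNP nr.
  suff : Defs.eval (Sup f) (a w) <= ratr r by rewrite leNgt rw.
  apply: ge_sup.
    by exists (Defs.eval f (ec (cint M s) (a w))), (cint M s).
  by move=> _ [x _ <-]; rewrite leNgt; apply/negP; exact: nr.
Qed.
End Los.

(** * Skolem functions and decisions *)

Lemma env_nil_eq (J : Type) (C : J -> Type) (a : env C [::]) : a = env_nil C.
Proof.
apply: functional_extensionality_dep => s; apply: functional_extensionality_dep => v.
by case: (match v in var G _ return if G is [::] then False else True with
  VZ _ _ => I | VS _ _ _ _ => I end).
Qed.

Section Operations.
Context (R : realType) (tau : nat -> nat) (mu : nat -> modulus R).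
Context (X Y : normedModType R) (T : {linear X -> Y}) (TS : op_respects tau mu T).
Variable sigma : Y -> X.
Let S := op_signature tau mu.
Let M : structure S := op_structure TS.
Context (L : formula_set S) (Lcount : countable_formula_set L).
Context (Lam : Type) (iota : nat -> Lam) (yd : Lam -> Y).
Hypothesis iota_inj : injective iota.
Hypothesis yd_dense : forall y (e : R), 0 < e -> exists d, `|y - yd d| < e.

(* A list of pairs encodes an assignment of variables in [X] and [Y] at once: a
   variable reads one component of its entry, truncated to the ball of its sort,
   and a single element is the head of a list.  All Skolem functions thus become
   binary operations on one type. *)
Definition tuples : Type := seq (X * Y).

Definition component (b : side) (p : X * Y) : op_space X Y b :=
  match b return op_space X Y b with Dom => p.1 | Cod => p.2 end.

Definition embed (b : side) : op_space X Y b -> X * Y :=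
  match b return op_space X Y b -> X * Y with
  | Dom => fun x => (x, 0)
  | Cod => fun y => (0, y)
  end.

Lemma component_embed b x : component b (embed x) = x. Proof. by case: b x. Qed.

Definition hd (q : tuples) : X * Y := head (0, 0) q.

Fixpoint env_of (G : seq op_sort) (q : tuples) : env (carrier M) G :=
  match G with
  | [::] => env_nil (carrier M)
  | s :: G' => env_cons (M := carrier M) (t := s) (trunc s.2 (component s.1 (hd q)))
                 (@env_of G' (behead q))
  end.
Arguments env_of : clear implicits.

Definition witness (G : seq op_sort) (s : op_sort) (phi : formula S (s :: G))
    (r : rat) (a : env (carrier M) G) : op_carrier X Y s :=
  if pselect (exists x : op_carrier X Y s,
    ratr r < Defs.eval phi (env_cons (M := carrier M) x a)) is left h
  then sval (cid h) else cint M s.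

Lemma witnessP G s (phi : formula S (s :: G)) r a :
  (exists x : op_carrier X Y s,
    ratr r < Defs.eval phi (env_cons (M := carrier M) x a)) ->
  ratr r < Defs.eval phi (env_cons (M := carrier M) (witness phi r a) a).
Proof. by rewrite /witness; case: pselect => // h _; exact: (svalP (cid h)). Qed.

Definition op_skolem (p : {G & formula S G}) (r : rat) (q _ : tuples) : tuples :=
  match projT1 p as G return formula S G -> tuples with
  | [::] => fun=> [::]
  | s :: G' => fun phi => [:: embed (bval (witness phi r (env_of G' q)))]
  end (projT2 p).

Definition op_nil (q1 q2 : tuples) : tuples := [::].
Definition op_cons (q1 q2 : tuples) : tuples := hd q1 :: q2.
Definition op_add (q1 q2 : tuples) : tuples :=
  [:: ((hd q1).1 + (hd q2).1, (hd q1).2 + (hd q2).2)].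
Definition op_scale (r : rat) (q1 q2 : tuples) : tuples :=
  [:: ((ratr r : R) *: (hd q1).1, (ratr r : R) *: (hd q1).2)].
Definition op_T (q1 q2 : tuples) : tuples := [:: (0, T (hd q1).1)].
Definition op_sigma (q1 q2 : tuples) : tuples := [:: (sigma (hd q1).2, 0)].
Definition op_trunc (n : nat) (q1 q2 : tuples) : tuples :=
  [:: (val (trunc n (hd q1).1), val (trunc n (hd q1).2))].

Definition operations : set (tuples -> tuples -> tuples) :=
  [set op_nil; op_cons; op_add; op_T; op_sigma] `|` range op_scale `|`
  range op_trunc `|`
  [set op_skolem x.1 x.2 | x in [set p | L (projT2 p)] `*` [set: rat]].

Lemma countableU (A : Type) (B C : set A) : countable B -> countable C ->
  countable (B `|` C).
Proof.
move=> cB cC; rewrite -bigcup2E.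
by apply: bigcup_countable => // -[|[|i]] _ //=.
Qed.

Lemma countable_operations : countable operations.
Proof.
rewrite /operations; apply: countableU; [apply: countableU; [apply: countableU|]|].
- exact: finite_set_countable.
- by apply: card_le_trans (countableP [set: rat]); exact: card_image_le.
- by apply: card_le_trans (countableP [set: nat]); exact: card_image_le.
- apply: card_le_trans (countableX Lcount (countableP [set: rat])).
  exact: card_image_le.
Qed.

(** The index is read in [Lam] because all decisions must share one set of values. *)
Definition select (P : nat -> Prop) : Lam :=
  if pselect (exists n, P n) is left h then iota (sval (cid h)) else iota 0.

Lemma selectP (P : nat -> Prop) : (exists n, P n) ->
  exists2 n, select P = iota n & P n.
Proof.
rewrite /select; case: pselect => // h _.
by exists (sval (cid h)); last exact: (svalP (cid h)).
Qed.

Definition de_sup (p : {G & formula S G}) (r : rat) : tuples -> Lam :=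
  match projT2 p with
  | SupN G f => fun q => select (fun n => ratr r < Defs.eval (f n) (env_of G q))
  | _ => fun=> iota 0
  end.

Definition de_bound (q : tuples) : Lam :=
  select (fun n => `|(hd q).1| <= n%:R /\ `|(hd q).2| <= n%:R).

Lemma de_near_ex (m : nat) (q : tuples) : exists d, `|(hd q).2 - yd d| < m.+1%:R^-1.
Proof. by apply: yd_dense; rewrite invr_gt0. Qed.

Definition de_near (m : nat) (q : tuples) : Lam := sval (cid (de_near_ex m q)).

Lemma de_nearP m q : `|(hd q).2 - yd (de_near m q)| < m.+1%:R^-1.
Proof. exact: (svalP (cid (de_near_ex m q))). Qed.

Definition decisions : set (tuples -> Lam) :=
  [set de_bound] `|` range de_near `|`
  [set de_sup x.1 x.2 | x in [set p | L (projT2 p)] `*` [set: rat]].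

Lemma countable_decisions : countable decisions.
Proof.
rewrite /decisions; apply: countableU; [apply: countableU|].
- exact: countable1.
- by apply: card_le_trans (countableP [set: nat]); exact: card_image_le.
- apply: card_le_trans (countableX Lcount (countableP [set: rat])).
  exact: card_image_le.
Qed.

End Operations.
Arguments env_of {R tau mu X Y T} TS G q.

(** * The model with a separable codomain *)

Section Build.
Context (R : realType) (tau : nat -> nat) (mu : nat -> modulus R).
Context (X Y : completeNormedModType R) (T : {linear X -> Y}) (TS : op_respects tau mu T).
Variable (sigma : Y -> X) (B C : R).
Hypothesis B0 : 0 <= B.
Hypothesis TB : forall x, `|T x| <= B * `|x|.
Hypothesis C0 : 0 <= C.
Hypothesis sigmaC : forall y, `|sigma y| <= C * `|y|.
Hypothesis sigmaK : forall y, T (sigma y) = y.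
Let S := op_signature tau mu.
Let M : structure S := op_structure TS.
Context (L : formula_set S) (Lfrag : fragment L) (Lcont : continuous_formula_set L).
Context (Lam : Type) (iota : nat -> Lam) (yd : Lam -> Y).
Hypothesis iota_inj : injective iota.
Hypothesis yd_dense : forall y (e : R), 0 < e -> exists d, `|y - yd d| < e.
Context (Om : Type) (U : set_system Om) (UU : UltraFilter U).
Variables (N : set (Om -> tuples X Y)) (Lam0 : set Lam).
Hypothesis N0 : N !=set0.
Hypothesis N_op : forall th a b, operations TS sigma L th -> N a -> N b ->
  N (fun w => th (a w) (b w)).
Hypothesis N_de : forall de a, decisions TS L iota yd_dense de -> N a ->
  exists2 d, Lam0 d & U [set w | de (a w) = d].

Definition name (b : side) (f : Om -> op_space X Y b) : Prop :=
  exists2 u, N u & f = fun w => component b (hd (u w)).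

Lemma opP th : [set op_nil (X:=X) (Y:=Y); @op_cons R X Y; @op_add R X Y; op_T T;
  op_sigma sigma] th -> operations TS sigma L th.
Proof. by move=> ?; do 3!left. Qed.

Lemma N_nil : N (fun=> [::]).
Proof.
have [u Nu] := N0.
by apply: (N_op (th := @op_nil R X Y) _ Nu Nu); apply: opP; left; left; left; left.
Qed.

Lemma N_cons u v : N u -> N v -> N (fun w => hd (u w) :: v w).
Proof.
by move=> Nu Nv; apply: (N_op (th := @op_cons R X Y) _ Nu Nv); apply: opP; do 3!left; right.
Qed.

Lemma name0 b : name (b := b) (fun=> 0).
Proof. by exists (fun=> [::]); [exact: N_nil|case: b]. Qed.

Lemma nameD b (f g : Om -> op_space X Y b) : name f -> name g -> name (fun w => f w + g w).
Proof.
move=> [u Nu ->] [v Nv ->]; exists (fun w => op_add (u w) (v w)); last by case: b f g.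
by apply: (N_op _ Nu Nv); apply: opP; do 2!left; right.
Qed.

Lemma nameZ b (q : rat) (f : Om -> op_space X Y b) : name f ->
  name (fun w => (ratr q : R) *: f w).
Proof.
move=> [u Nu ->]; exists (fun w => op_scale q (u w) (u w)); last by case: b f.
by apply: (N_op _ Nu Nu); do 2!left; right; exists q.
Qed.

Lemma name_T (f : Om -> X) : name (b := Dom) f -> name (b := Cod) (fun w => T (f w)).
Proof.
move=> [u Nu ->]; exists (fun w => op_T T (u w) (u w)) => //.
by apply: (N_op _ Nu Nu); apply: opP; left; right.
Qed.

Lemma name_sigma (f : Om -> Y) : name (b := Cod) f -> name (b := Dom) (fun w => sigma (f w)).
Proof.
move=> [u Nu ->]; exists (fun w => op_sigma sigma (u w) (u w)) => //.
by apply: (N_op _ Nu Nu); apply: opP; right.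
Qed.

Lemma name_trunc b n (f : Om -> op_space X Y b) : name f ->
  name (fun w => val (trunc n (f w))).
Proof.
move=> [u Nu ->]; exists (fun w => op_trunc n (u w) (u w)); last by case: b f.
by apply: (N_op _ Nu Nu); left; right; exists n.
Qed.

(** As [iota] is injective, a constant value of the selection is a constant index. *)
Lemma select_ae (P : nat -> Om -> Prop) d :
  (forall w, exists n, P n w) ->
  U [set w | select iota (P^~ w) = d] -> exists n, U [set w | P n w].
Proof.
move=> Pex Ud; have [w0 w0d] := filter_ex Ud.
have [n nE _] := selectP iota (Pex w0).
exists n; apply: filterS Ud => w /= wd.
have [m mE Pm] := selectP iota (Pex w).
suff -> : n = m by [].
by apply: iota_inj; rewrite -nE -mE wd w0d.
Qed.

(** An integer bound is among the decisions, so one bound holds almost everywhere. *)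
Lemma name_bounded b (f : Om -> op_space X Y b) : name f ->
  exists K : R, U [set w | `|f w| <= K].
Proof.
move=> [u Nu ->].
have [|d _ Ud] := N_de (de := de_bound iota) _ Nu; first by left; left.
have bd (q : X * Y) : exists n : nat, `|q.1| <= n%:R /\ `|q.2| <= n%:R.
  exists (maxn (Num.bound `|q.1|) (Num.bound `|q.2|)); split.
    apply: ltW; apply: lt_le_trans (archi_boundP _) _ => //.
    by rewrite ler_nat leq_maxl.
  apply: ltW; apply: lt_le_trans (archi_boundP _) _ => //.
  by rewrite ler_nat leq_maxr.
have [n Un] := @select_ae (fun n w => `|(hd (u w)).1| <= n%:R /\ `|(hd (u w)).2| <= n%:R) d
  (fun w => bd _) Ud.
by exists n%:R; apply: filterS Un => w [? ?]; case: b f.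
Qed.

Definition space_of b : name_space (op_space X Y b) U :=
  NameSpace UU (@name0 b) (@nameD b) (@nameZ b) (@name_bounded b).

Definition EX : name_space X U := space_of Dom.
Definition EY : name_space Y U := space_of Cod.
Definition X' : completeNormedModType R := redpow EX.
Definition Y' : completeNormedModType R := redpow EY.

Lemma apxT h : apx EX h -> apx EY (fun w => T (h w)).
Proof.
(* [B] may be 0, hence the denominator [B + 1]. *)
move=> hH e e0; have d0 : 0 < e / (B + 1) by rewrite divr_gt0// ltr_wpDl.
have [f Ef hf] := hH _ d0; exists (fun w => T (f w)); first exact: name_T.
apply: filterS hf => w /=; rewrite ler_pdivlMr ?ltr_wpDl// => hf.
rewrite -raddfB; apply: le_trans (TB _) _; apply: le_trans hf.
by rewrite mulrC ler_wpM2l// lerDl.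
Qed.

Definition T'_fun (x : X') : Y' := cls EY (fun w => T (rep x w)).

Lemma T'E h : apx EX h -> T'_fun (cls EX h) = cls EY (fun w => T (h w)).
Proof.
move=> hH; apply: clsE; [by apply: apxT; exact: rep_apx|exact: apxT|].
apply/(nullP EY) => e e0; have d0 : 0 < e / (B + 1) by rewrite divr_gt0// ltr_wpDl.
have /(nullP EX)/(_ _ d0) := rep_cls hH; apply: filterS => w /=.
rewrite ler_pdivlMr ?ltr_wpDl// => hf.
rewrite -raddfB; apply: le_trans (TB _) _; rewrite distrC; apply: le_trans hf.
by rewrite mulrC ler_wpM2l// lerDl.
Qed.

Lemma T'_linear : linear T'_fun.
Proof.
move=> r x y; rewrite -(cls_rep x) -(cls_rep y).
have xH := rep_apx x; have yH := rep_apx y.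
rewrite clsZ// clsD//; last exact: apxZ.
rewrite !T'E//; last by apply: apxD => //; exact: apxZ.
rewrite clsZ; last exact: apxT.
rewrite clsD; [|by apply: apxZ; exact: apxT|exact: apxT].
by congr cls; apply/funext => w; rewrite linearP.
Qed.

HB.instance Definition _ := @GRing.isLinear.Build R X' Y' *:%R T'_fun T'_linear.

Definition T' : {linear X' -> Y'} := T'_fun.

Lemma T'_bounded x : `|T' x| <= B * `|x|.
Proof.
rewrite -(cls_rep x) /T' /= T'E; last exact: rep_apx.
have h := ulim_scale UU B (norm_cls (rep_apx x)).
apply: (ulim_le UU (norm_cls (apxT (rep_apx x))) h).
by apply: filterE => w /=.
Qed.

Lemma scaled_le (a b : R) : (forall t, 0 < t < 1 -> t * a <= b) -> a <= b.
Proof.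
move=> H; rewrite leNgt; apply/negP => ba.
have [a0|a0] := lerP a 0; first by have := H (1 / 2); lra.
have b0 : 0 <= b by have := H (1 / 2); lra.
pose t := (a + b) / 2 / a.
have tE : t * a = (a + b) / 2 by rewrite divfK// gt_eqF.
have := H t; rewrite tE /t ltr_pdivlMr// ltr_pdivrMr// mul0r mul1r; lra.
Qed.

Lemma eventually_le h n (t : R) : apx EX h -> 0 < t < 1 -> `|cls EX h| <= n.+1%:R ->
  U [set w | `|t *: h w| <= n.+1%:R].
Proof.
move=> hH /andP[t0 t1] hn.
have := norm_cls (apxZ t hH); rewrite -clsZ// normrZ gtr0_norm// => tl.
have : t * `|cls EX h| < n.+1%:R.
  apply: le_lt_trans (_ : t * n.+1%:R < _); first by rewrite ler_pM2l.
  by rewrite gtr_pMl// ltr0n.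
by move=> /(ulim_lt UU tl); apply: filterS => w /= /ltW.
Qed.

(* An element of norm at most [n.+1] need not be represented by functions into
   the ball of radius [n.+1], but its multiples by [t < 1] are. *)
Lemma T'_respects : op_respects tau mu T'.
Proof.
move=> n; have [Tn Tmod] := TS n; split=> [x|e e0 x y].
  rewrite -(cls_rep x) => xn; apply: scaled_le => t t01; have xH := rep_apx x.
  have /andP[t0 t1] := t01.
  rewrite -[t in t * _](gtr0_norm t0) -normrZ -linearZ clsZ// /T' /= T'E; last exact: apxZ.
  apply: (ulim_le UU (norm_cls (apxT (apxZ t xH))) (ulim_cst UU _)).
  by apply: filterS (eventually_le xH t01 xn) => w; exact: Tn.
rewrite -(cls_rep x) -(cls_rep y) => xn yn xy.
have xH := rep_apx x; have yH := rep_apx y.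
rewrite ler_pdivrMr ?mulr_gt0//; apply: scaled_le => t t01.
have /andP[t0 t1] := t01.
have xtH := apxZ t xH; have ytH := apxZ t yH.
rewrite -[t in t * _](gtr0_norm t0) -normrZ scalerBr -!linearZ clsZ// clsZ//.
rewrite /T' /= !T'E// clsB; [|exact: apxT|exact: apxT].
apply: (ulim_le UU (norm_cls (apxB (apxT xtH) (apxT ytH))) (ulim_cst UU _)).
have xyt : `|cls EX (fun w => t *: rep x w - t *: rep y w)| < mu n e * (2 * n.+1%:R).
  rewrite -clsB// -!clsZ// -scalerBr normrZ gtr0_norm//.
  move: xy; rewrite ltr_pdivrMr ?mulr_gt0//; apply: le_lt_trans.
  by rewrite ler_piMl// ltW.
have := ulim_lt UU (norm_cls (apxB xtH ytH)) xyt.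
apply: filterS3 (eventually_le xH t01 xn) (eventually_le yH t01 yn) => w /= xw yw xyw.
have := Tmod e e0 _ _ xw yw; rewrite ltr_pdivrMr ?mulr_gt0// => /(_ xyw).
by rewrite ler_pdivrMr ?mulr_gt0.
Qed.

(** The section [sigma] need not be continuous, so it acts on names but not on their limits. A name
    within |y| / 2 of [y] has norm at most 3/2 |y|, and its image under [sigma] is an approximate
    preimage, which [almost_surjective] improves to an exact one. *)
Lemma T'_surjective y : exists x, T' x = y.
Proof.
have C'0 : 0 <= 3 / 2 * C by rewrite mulr_ge0// divr_ge0.
have [|x _ <-] := almost_surjective C'0 T'_bounded _ y; last by exists x.
move=> {}y; have [->|y0] := eqVneq y 0.
  by exists 0; rewrite ?normr0 ?mulr0// raddf0 subr0 normr0 mul0r.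
have ny : 0 < `|y| / 2 by rewrite divr_gt0// normr_gt0.
have [f nf yf] := rep_apx y ny.
have fH := apx_name nf; have sH := apx_name (E := EX) (name_sigma nf).
have yfn : `|y - cls EY f| <= `|y| / 2.
  rewrite -[in leLHS](cls_rep y) clsB//; last exact: rep_apx.
  exact: (ulim_le UU (norm_cls (apxB (rep_apx y) fH)) (ulim_cst UU _)).
exists (cls EX (fun w => sigma (f w))).
  have : `|cls EX (fun w => sigma (f w))| <= C * `|cls EY f|.
    apply: (ulim_le UU (norm_cls sH) (ulim_scale UU C (norm_cls fH))).
    by apply: filterE => w /=.
  have : `|cls EY f| <= 3 / 2 * `|y|.
    have := ler_distD (cls EY f) y 0; have := ler_normB y (y - cls EY f).
    rewrite subKr; lra.
  move=> h1 /le_trans; apply; have := ler_wpM2l C0 h1; lra.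
rewrite /T' /= T'E//; have -> : (fun w => T (sigma (f w))) = f; last by [].
by apply/funext => w; rewrite sigmaK.
Qed.

Definition pi (b : side) : (Om -> op_space X Y b) -> op_space X' Y' b :=
  match b with Dom => cls EX | Cod => cls EY end.

(** A whole assignment of names is packed into a single name, to which the Skolem operations and the
    decisions apply. *)
Lemma name_env G (a : Om -> env (carrier M) G) : nm_env name a ->
  exists2 u, N u & forall w, env_of TS G (u w) = a w.
Proof.
elim: G a => [|s G IH] a na.
  by exists (fun=> [::]); [exact: N_nil|move=> w; rewrite [RHS]env_nil_eq].
have [v Nv vE] := IH (fun w t x => a w t (VS x)) (fun t x => na t (VS x)).
have [u Nu uE] := na s VZ.
exists (fun w => hd (u w) :: v w); first exact: N_cons.
move=> w; apply: functional_extensionality_dep => t.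
apply: functional_extensionality_dep => x; move: t x; apply: var_case => [|t x] /=.
  apply: bval_inj; have := congr1 (@^~ w) uE => /= <-.
  by rewrite /bval trunc_val.
by rewrite vE.
Qed.

Lemma name_skolem G s (phi : formula S (s :: G)) : L phi ->
  forall a : Om -> env (carrier M) G, nm_env name a -> forall r : rat,
  exists f : Om -> op_carrier X Y s, name (fun w => bval (f w)) /\
    forall w, (exists x : op_carrier X Y s,
        ratr r < Defs.eval phi (env_cons (M := carrier M) x (a w))) ->
      ratr r < Defs.eval phi (env_cons (M := carrier M) (f w) (a w)).
Proof.
move=> Lphi a /name_env[u Nu uE] r.
exists (fun w => witness phi r (a w)); split=> [|w]; last exact: witnessP.
exists (fun w => op_skolem TS (existT _ (s :: G) phi) r (u w) (u w)).
  by apply: (N_op _ Nu Nu); right; exists (existT _ (s :: G) phi, r).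
by apply/funext => w; rewrite /op_skolem /= component_embed uE.
Qed.

Lemma name_omit G (phi : nat -> formula S G) : L (SupN phi) ->
  forall a : Om -> env (carrier M) G, nm_env name a -> forall r : rat,
  U [set w | exists n, ratr r < Defs.eval (phi n) (a w)] ->
  exists n, U [set w | ratr r < Defs.eval (phi n) (a w)].
Proof.
move=> Lphi a /name_env[u Nu uE] r Uex.
have [|d _ Ud] := N_de (de := de_sup TS iota (existT _ G (SupN phi)) r) _ Nu.
  by right; exists (existT _ G (SupN phi), r).
(* The selection needs a witness at every [w], but one is known to exist only almost everywhere; the
   implication provides the missing ones. *)
pose P n w := (exists m, ratr r < Defs.eval (phi m) (a w)) ->
  ratr r < Defs.eval (phi n) (a w).
have [w||n Un] := @select_ae P d _ _.
- have [[n nP]|nex] := pselect (exists m, ratr r < Defs.eval (phi m) (a w)).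
    by exists n => _.
  by exists 0 => /nex.
- apply: filterS2 Uex Ud => w wex /= <-; rewrite /de_sup /= uE.
  congr select; apply/funext => n; apply/propext; split=> [/(_ wex)//|? _].
  by [].
- by exists n; apply: filterS2 Uex Un => w wex /(_ wex).
Qed.

Lemma pi_name0 b : pi (b := b) (fun=> 0) = 0. Proof. by case: b. Qed.

Lemma pi_nameD b (f g : Om -> op_space X Y b) : name f -> name g ->
  pi (fun w => f w + g w) = pi f + pi g.
Proof.
by case: b f g => f g nf ng; rewrite /pi clsD//; exact: apx_name.
Qed.

Lemma pi_nameZ b (q : rat) (f : Om -> op_space X Y b) : name f ->
  pi (fun w => (ratr q : R) *: f w) = (ratr q : R) *: pi f.
Proof. by case: b f => f nf; rewrite /pi clsZ//; exact: apx_name. Qed.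

Lemma pi_nameT (f : Om -> X) : name (b := Dom) f ->
  pi (b := Cod) (fun w => T (f w)) = T' (pi (b := Dom) f).
Proof. by move=> nf; rewrite /pi /T' /= T'E//; exact: apx_name. Qed.

Lemma pi_norm b (f : Om -> op_space X Y b) : name f ->
  ulim U (fun w => `|f w|) `|pi f|.
Proof. by case: b f => f nf; apply: norm_cls; exact: apx_name. Qed.

Lemma pi_eq b (f g : Om -> op_space X Y b) : name f -> name g ->
  U [set w | f w = g w] -> pi f = pi g.
Proof. by case: b f g => f g nf ng fg; apply: cls_eq => //; exact: apx_name. Qed.

Lemma cls_dense (V : normedModType R) (E : name_space V U) (x : redpow E) e : 0 < e ->
  exists2 f, names E f & `|x - cls E f| < e.
Proof.
move=> e0; have e20 : 0 < e / 2 by rewrite divr_gt0.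
have [f nf xf] := rep_apx x e20; exists f => //.
have fH := apx_name nf; rewrite -(cls_rep x) clsB//; last exact: rep_apx.
apply: le_lt_trans (ulim_le UU (norm_cls (apxB (rep_apx x) fH)) (ulim_cst UU _) xf) _.
by rewrite ltr_pdivrMr// ltr_pMr// ltr1n.
Qed.

Lemma pi_dense b (x : op_space X' Y' b) (e : R) : 0 < e ->
  exists2 f, name f & `|x - pi f| < e.
Proof.
by case: b x => x e0; [have [f nf xf] := @cls_dense _ EX x e e0
  |have [f nf xf] := @cls_dense _ EY x e e0]; exists f.
Qed.

(** The value of a sentence in the original structure does not depend on [w], so its limit is that
    same value. *)
Lemma equiv_L : equiv_in L (op_structure TS) (op_structure T'_respects).
Proof.
move=> phi Lphi.
have h : ulim U (fun=> Defs.eval phi (env_nil (carrier M)))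
    (Defs.eval phi (env_nil (carrier (op_structure T'_respects)))).
  apply: (@los _ _ _ _ _ _ TS _ _ _ T'_respects _ _ UU name pi) => //.
  - exact: name0.
  - exact: pi_name0.
  - exact: nameD.
  - exact: pi_nameD.
  - exact: nameZ.
  - exact: pi_nameZ.
  - exact: name_T.
  - exact: pi_nameT.
  - exact: name_trunc.
  - exact: pi_norm.
  - exact: pi_eq.
  - exact: pi_dense.
  - exact: Lfrag.
  - exact: Lcont.
  - exact: name_skolem.
  - exact: name_omit.
  - exact: Lphi.
  - by move=> s v; case: (match v in var G _ return if G is [::] then False else True with
      VZ _ _ => I | VS _ _ _ _ => I end).
exact: (ulim_unique UU (ulim_cst UU _) h).
Qed.

Lemma name_near f (m : nat) : name (b := Cod) f ->
  exists2 d, Lam0 d & U [set w | `|f w - yd d| < m.+1%:R^-1].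
Proof.
move=> [u Nu ->].
have [|d Ld Ud] := N_de (de := de_near yd_dense m) _ Nu; first by left; right; exists m.
by exists d => //; apply: filterS Ud => w /= <-; exact: de_nearP.
Qed.

(** Almost everywhere a named element stays near one of countably many points [yd d]. The constant
    functions at these points need not be names, so one class is chosen near each point at each
    scale. *)
Lemma separable_Y' : countable Lam0 -> Defs.separable Y'.
Proof.
move=> cLam0.
pose good (p : Lam * nat) := [set y : Y' | exists f, [/\ name (b := Cod) f,
  y = cls EY f & U [set w | `|f w - yd p.1| < p.2.+1%:R^-1]]].
exists [set xget 0 (good p) | p in Lam0 `*` [set: nat]].
  by apply: card_le_trans (countableX cLam0 (countableP [set: nat])); exact: card_image_le.
move=> O [y Oy] openO.
have /nbhs_ballP[e /= e0 eO] : nbhs y O by exact: open_nbhs_nbhs.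
have e20 : 0 < e / 2 by rewrite divr_gt0.
have [f nf yf] := @cls_dense _ EY y _ e20.
(* Two named elements near the same [yd d] are at distance at most twice 1 / (m + 1), which is to be
   below e / 2. *)
have [m me] := inv_nat_small (divr_gt0 e0 (ltr0n R 4)).
have [d Ld fd] := name_near m nf.
have := @xgetPex _ 0 (good (d, m)); case; first by exists (cls EY f), f.
move=> g [ng gE gd]; exists (xget 0 (good (d, m))); split; last by exists (d, m).
apply: eO; rewrite -ball_normE /= gE.
apply: le_lt_trans (ler_distD (cls EY f) _ _) _.
have fH := apx_name (E := EY) nf; have gH := apx_name (E := EY) ng.
pose r : R := m.+1%:R^-1; suff : `|cls EY f - cls EY g| <= 2 * r.
  move=> /le_trans fg; rewrite [ltRHS]splitr; apply: ltr_leD yf _; apply: fg.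
  by move: me; rewrite -/r; lra.
rewrite clsB//; apply: (ulim_le UU (norm_cls (apxB fH gH)) (ulim_cst UU _)).
apply: filterS2 fd gd => w /= fw gw.
apply: le_trans (ler_distD (yd d) _ _) _; rewrite [`|yd d - _|]distrC mulr_natl mulr2n.
by apply: lerD; exact: ltW.
Qed.

Context (W : choiceType) (lt : W -> W -> Prop).
Hypothesis W_omega1 : omega1_order lt.
Hypothesis N_card : N #<= [set: W * nat].
Variable e_ : W -> Om -> X.
Hypothesis N_e : forall i, N (fun w => [:: (e_ i w, 0)]).
Hypothesis e_far : forall i j, lt i j -> U [set w | 1 <= `|e_ i w - e_ j w|].

(** The coordinates give uncountably many points at mutual distance at least 1, and a point of [D]
    is within 1 / 2 of at most one of them. *)
Lemma uncountable_dense (D : set X') : dense D -> ~ countable D.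
Proof.
move=> dD cD.
have ne i : name (b := Dom) (e_ i) by exists (fun w => [:: (e_ i w, 0)]).
have eH i := apx_name (E := EX) (ne i).
pose c i : X' := cls EX (e_ i).
have far i j : lt i j -> 1 <= `|c i - c j|.
  move=> ij; rewrite /c clsB//.
  exact: (ulim_le UU (ulim_cst UU _) (norm_cls (apxB (eH i) (eH j))) (e_far ij)).
have near_c i : exists x, D x /\ `|c i - x| < 1 / 2.
  have [|x []] := dD (ball (c i) (1 / 2)) _ (ball_open _ _).
    by exists (c i); apply: ballxx; rewrite divr_gt0.
  by rewrite -ball_normE => cx Dx; exists x.
have [x xP] := choice near_c.
have [_ _ tot _ nW] := W_omega1; apply: nW; apply: card_le_trans cD.
have sep i j : x i = x j -> ~ lt i j.
  move=> xij /far; have := ler_distD (x i) (c i) (c j).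
  have := (xP i).2; have := (xP j).2; rewrite -xij [`|c j - _|]distrC; lra.
apply: (@card_le_of_inj _ _ _ _ x) => [i _|i j _ _ xij]; first exact: (xP i).1.
by case: (tot i j) => // /sep; [move/(_ xij)|move/(_ (esym xij))].
Qed.

(** The named elements are dense and, like [W * nat], inject into every uncountable set; in
    particular into every dense set. *)
Lemma density_X' : density_aleph1 X'.
Proof.
pose D := [set cls EX (fun w => component Dom (hd (u w))) | u in N] : set X'.
have dD : dense D.
  move=> O [x Ox] openO.
  have /nbhs_ballP[e /= e0 eO] : nbhs x O by exact: open_nbhs_nbhs.
  have [f [u Nu fE] xf] := @cls_dense _ EX x _ e0.
  exists (cls EX f); split; first by apply: eO; rewrite -ball_normE.
  by exists u => //; rewrite fE.
have cD (A : Type) (E : set A) : ~ countable E -> D #<= E.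
  move=> nE; apply: card_le_trans (card_image_le _ _) _.
  exact: card_le_trans N_card (omega1_card_le W_omega1 nE).
exists D; first by split=> // E dE; apply: cD; exact: uncountable_dense.
by split; [exact: uncountable_dense|move=> A E /cD].
Qed.

Lemma generic_structure : countable Lam0 ->
  exists (X1 Y1 : completeNormedModType R) (T1 : {linear X1 -> Y1})
         (TS1 : op_respects tau mu T1),
    [/\ Defs.separable Y1, density_aleph1 X1, bounded_operator T1,
        (forall y : Y1, exists x : X1, T1 x = y) &
        equiv_in L (op_structure TS) (op_structure TS1)].
Proof.
move=> cLam0; exists X', Y', T', T'_respects; split.
- exact: separable_Y'.
- exact: density_X'.
- by exists B; exact: T'_bounded.
- exact: T'_surjective.
- exact: equiv_L.
Qed.

End Build.

(** * The ideal of small sets and the final assembly *)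

Lemma infinite_dense (R : realType) (V : normedModType R) (D : set V) :
  infinite_dimensional V -> dense D -> infinite_set D.
Proof.
move=> Vinf dD fD; have /finite_seqP[s sE] := fD.
(* A point outside the span of [D] lies outside [D]; a finite set is closed, so its complement is a
   nonempty open set that misses [D]. *)
have [x xs] := Vinf (size s) (fun i => nth 0 s i).
have nDx : ~ D x.
  rewrite sE /= => xin; have i := index_mem x s; rewrite xin in i.
  apply: (xs (fun j => if j == Ordinal i then 1 else 0)).
  rewrite (bigD1 (Ordinal i))//= eqxx scale1r nth_index// big1 ?addr0// => j ji.
  by rewrite (negbTE ji) scale0r.
have cD : closed D.
  have acc : accessible_space V by apply: hausdorff_accessible; exact: norm_hausdorff.
  exact: (accessible_finite_set_closed.1 acc).
have [|y [nDy Dy]] := dD (~` D) _ (closed_openC cD); first by exists x.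
exact: nDy.
Qed.

Section SmallSets.
Context (R : realType) (V : normedModType R) (Lam : Type).

Definition small (A : set V) : Prop :=
  exists c : Lam -> V, forall x, A x -> exists d, `|x - c d| < 1.

Lemma small_sub (A B : set V) : A `<=` B -> small B -> small A.
Proof. by move=> AB [c cB]; exists c => x /AB/cB. Qed.

(** The centres of [Lam] many covers are indexed by pairs, which [p] codes back into [Lam]. *)
Lemma small_bigcup (p : Lam * Lam -> Lam) (F : Lam -> set V) : injective p ->
  (forall d, small (F d)) -> small (\bigcup_d F d).
Proof.
move=> p_inj Fs; have [c cP] := choice Fs.
exists (fun d => if pselect (exists q, p q = d) is left h
  then c (sval (cid h)).1 (sval (cid h)).2 else 0) => x [d _ /cP[d' xd]].
exists (p (d, d')); case: pselect => [h|[]]; last by exists (d, d').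
by have /p_inj -> := svalP (cid h).
Qed.

Lemma small_near (d0 : Lam) (x : V) : small [set y | `|x - y| < 1].
Proof. by exists (fun=> x) => y /=; exists d0; rewrite distrC. Qed.

(** By homogeneity one scale is enough: dividing the centres of a cover of the whole space by n + 1
    gives covers by balls of radius 1 / (n + 1), hence a dense set no larger than [nat * Lam], which
    injects into [Lam]. *)
Lemma not_smallT (iota : nat -> Lam) (p : Lam * Lam -> Lam) (E : set V) :
  injective iota -> injective p -> least_dense E -> ~ (E #<= [set: Lam]) -> ~ small setT.
Proof.
move=> iota_inj p_inj [_ Eleast] nE [c cT]; apply: nE.
pose E' := range (fun q : nat * Lam => (q.1.+1%:R^-1 : R) *: c q.2).
have dE' : dense E'.
  move=> O [x Ox] openO.
  have /nbhs_ballP[e /= e0 eO] : nbhs x O by exact: open_nbhs_nbhs.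
  have [n ne] := inv_nat_small e0; have [d xd] := cT (n.+1%:R *: x) I.
  exists (n.+1%:R^-1 *: c d); split; last by exists (n, d).
  apply: eO; rewrite -ball_normE /=; apply: lt_trans ne.
  have -> : x - n.+1%:R^-1 *: c d = (n.+1%:R^-1 : R) *: (n.+1%:R *: x - c d).
    by rewrite scalerBr scalerA mulVf ?scale1r.
  by rewrite normrZ gtr0_norm ?invr_gt0// gtr_pMr ?invr_gt0.
apply: card_le_trans (Eleast _ dE') _; apply: card_le_trans (card_image_le _ _) _.
apply: (@card_le_of_inj _ _ _ _ (fun q => p (iota q.1, q.2))) => // -[m d] [n d'] _ _.
by move=> /p_inj[/iota_inj /= -> ->].
Qed.

End SmallSets.

Theorem corollary5p4 (R : realType) (X Y : completeNormedModType R)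
    (T : {linear X -> Y})
    (Xinf : infinite_dimensional X) (Yinf : infinite_dimensional Y)
    (densYX : density_lt Y X)
    (Tbounded : bounded_operator T) (Tsurj : forall y : Y, exists x : X, T x = y)
    (tau : nat -> nat) (mu : nat -> modulus R) (TS : op_respects tau mu T)
    (L : formula_set (op_signature tau mu)) (Lfrag : fragment L)
    (Lcount : countable_formula_set L) (Lcont : continuous_formula_set L) :
  exists (X' Y' : completeNormedModType R) (T' : {linear X' -> Y'})
         (TS' : op_respects tau mu T'),
    [/\ separable Y', density_aleph1 X', bounded_operator T',
        (forall y : Y', exists x : X', T' x = y) &
        equiv_in L (op_structure TS) (op_structure TS')].
Proof.
have [B0 TB0] := Tbounded.
have TB x : `|T x| <= `|B0| * `|x|.
  by apply: le_trans (TB0 x) _; rewrite ler_wpM2r// ler_norm.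
have [C C0 CP] := open_mapping TB Tsurj.
have sig_ex y : exists x, `|x| <= C * `|y| /\ T x = y by have [x ? ?] := CP y; exists x.
have [sigma sigmaP] := choice sig_ex.
have [D [E [leastD leastE _ nED]]] := densYX.
(* [Lam] indexes the unit balls of the covers, the values of the decisions and, through [sval], a
   dense subset of [Y]. *)
pose Lam := {y : Y | D y}.
have /infiniteP Dinf := infinite_dense Yinf leastD.1.
have [iota0 [iota0D iota0_inj]] := card_le_inj Dinf (ex_intro _ 0 I).
pose iota n : Lam := exist _ (iota0 n) (iota0D n I).
have iota_inj : injective iota.
  by move=> m n /(congr1 sval) /= mn; apply: iota0_inj; rewrite ?inE.
have [p p_inj] := infinite_square iota_inj.
have yd_dense y (e : R) : 0 < e -> exists d : Lam, `|y - sval d| < e.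
  move=> e0; have [|z [yz Dz]] := leastD.1 (ball y e) _ (ball_open _ _).
    by exists y; exact: ballxx.
  by exists (exist _ z Dz); move: yz; rewrite -ball_normE.
have nE : ~ (E #<= [set: Lam]).
  move=> EL; apply: nED; apply: card_le_trans EL _.
  apply: (@card_le_of_inj _ _ _ _ sval) => [[y Dy]//|d d' _ _]; exact: sval_inj.
have smallT := not_smallT iota_inj p_inj leastE nE.
have [W [lt W_omega1]] := omega1_exists.
(* Two elements of [Lam] serve as truth values in the construction of the ultrafilter. *)
have tt_ff : iota 0 <> iota 1 by move/iota_inj.
have [U [N [Lam0 [[UU cLam0] N_e N_op N_de [far Ncard]]]]] :=
  generic_names W_omega1 (@small_sub R X Lam) (fun F => small_bigcup p_inj)
    smallT (small_near (iota 0)) 0 tt_ff (fun x => [:: (x, 0)] : tuples X Y)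
    (countable_operations TS sigma Lcount) (countable_decisions TS Lcount iota yd_dense).
have N0 : N !=set0.
  have [i _] : [set: W] !=set0.
    have [_ _ _ _ nW] := W_omega1.
    by apply/set0P/negP => /eqP W0; apply: nW; rewrite W0.
  by exists (fun w => [:: (w i, 0)]).
apply: (generic_structure (sigma := sigma) (B := `|B0|) (C := C) (e_ := fun i w => w i)
  _ TB C0 _ _ Lfrag Lcont iota_inj UU N0 N_op N_de W_omega1 Ncard N_e _ cLam0) => //.
- by move=> y; have [] := sigmaP y.
- by move=> y; have [] := sigmaP y.
- by move=> i j /far; apply: filterS => w /= /negP; rewrite -leNgt.
Qed.
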